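(* Let $A$ be a strongly standardly stratified algebra with characteristic tilting module $T$. Then $\operatorname{fdim}(A)\leq \operatorname{fdim}_{\Delta}(A)+\operatorname{pd}(T)$.
   Context: $A$ is a finite-dimensional, associative, unital algebra over an algebraically closed field $\Bbbk$; $A\text{-mod}$ is the category of finite-dimensional left $A$-modules. The isoclasses of simple modules are indexed by $\Lambda=\{1,\dots,n\}$ with its natural order; $L(\lambda)$, $P(\lambda)$, $I(\lambda)$ are the simple module, its projective cover and injective envelope. The standard module is $\Delta(\lambda)=P(\lambda)/\operatorname{Trace}_{P^{>\lambda}}(P(\lambda))$ where $P^{>\lambda}=\bigoplus_{\mu>\lambda}P(\mu)$; the costandard module $\nabla(\lambda)$ is the largest submodule of $I(\lambda)$ all of whose composition factors are $L(\mu)$ with $\mu\le\lambda$, and the proper costandard module $\overline{\nabla}(\lambda)$ is the largest submodule of $I(\lambda)$ whose composition factors are $L(\mu)$, $\mu\le\lambda$, with $L(\lambda)$ occurring exactly once. For a class $\mathcal M$ of modules, $\mathcal F(\mathcal M)$ is the full subcategory of modules having a finite filtration with subquotients in $\mathcal M$; $\mathcal F(\Delta)$, $\mathcal F(\overline{\nabla})$ are defined with $\mathcal M=\{\Delta(\lambda)\}$, resp. $\{\overline{\nabla}(\lambda)\}$. $A$ is strongly standardly stratified (SSS) if ${}_AA\in\mathcal F(\Delta)$. For an SSS-algebra, the characteristic tilting module $T$ is the (basic) module with $\operatorname{Add}(T)=\mathcal F(\Delta)\cap\mathcal F(\overline{\nabla})$. For a module $N$, $\dim_\Delta(N)$ is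 the minimal length $l$ of an exact sequence $0\to M_l\to\dots\to M_0\to N\to0$ with all $M_i\in\mathcal F(\Delta)$ ($\infty$ if none exists), and $\operatorname{fdim}_\Delta(A)$ is the supremum of $\dim_\Delta(M)$ over all modules $M$ with $\dim_\Delta(M)<\infty$. $\operatorname{fdim}(A)$ is the supremum of $\operatorname{pd}(M)$ over all modules $M$ of finite projective dimension. *)

(* Defs.v *)
(* Finite-dimensional modules over a finite-dimensional
   algebra A (an falgType over a field F), encoded concretely as matrix
   representations acting on row vectors. *)
From HB Require Import structures.
From mathcomp Require Import all_boot all_order all_algebra all_field.
Set Implicit Arguments. Unset Strict Implicit. Unset Printing Implicit Defensive.
Import GRing.Theory.
Import VectorInternalTheory.
Local Open Scope ring_scope.

Section Modules.
Variables (F : fieldType) (A : falgType F).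

(* A finite-dimensional left A-module: the underlying space is 'rV[F]_mdim,
   and a acts by  v |-> v *m mact a  (so that (ab).v = a.(b.v) reads
   mact (a*b) = mact b *m mact a). *)
Record amod := AMod {
  mdim : nat;
  mact : A -> 'M[F]_mdim;
  mact_lin : forall (k : F) (a b : A), mact (k *: a + b) = k *: mact a + mact b;
  mact1 : mact 1 = 1%:M;
  mactM : forall a b : A, mact (a * b) = mact b *m mact a }.

Definition ishom (M N : amod) (f : 'M[F]_(mdim M, mdim N)) :=
  forall a, mact M a *m f = f *m mact N a.

Definition submod (M : amod) (U : 'M[F]_(mdim M)) :=
  forall a, (U *m mact M a <= U)%MS.

Definition mod_iso (M N : amod) :=
  exists f : 'M[F]_(mdim M, mdim N), [/\ ishom f, row_free f & row_full f].

(* subquot M U V X : U <= V are subspaces of M, and the subquotient V/U is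
   isomorphic to X (via a linear map h defined on V, A-equivariant on V,
   onto X, with kernel U inside V). *)
Definition subquot (M : amod) (U V : 'M[F]_(mdim M)) (X : amod) :=
  (U <= V)%MS /\
  exists h : 'M[F]_(mdim M, mdim X),
    [/\ forall a, V *m (mact M a *m h) = V *m h *m mact X a,
        row_full (V *m h) & ((V :&: kermx h) == U)%MS].

Definition chain (M : amod) (U V : 'M[F]_(mdim M)) (l : nat)
  (s : nat -> 'M[F]_(mdim M)) :=
  [/\ (s 0 == U)%MS, (s l == V)%MS & forall i, (i <= l)%N -> submod (s i)].

Definition filt (C : amod -> Prop) (M : amod) (U V : 'M[F]_(mdim M)) :=
  exists l s, chain U V l s /\
    forall i, (i < l)%N -> exists X, C X /\ subquot (s i) (s i.+1) X.

Definition inF (C : amod -> Prop) (M : amod) := filt C (M := M) 0 1%:M.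

Definition simple (M : amod) :=
  (0 < mdim M)%N /\
  forall U : 'M[F]_(mdim M), submod U -> \rank U = 0%N \/ (U == 1%:M)%MS.

Definition projective (P : amod) :=
  forall (M N : amod) (g : 'M[F]_(mdim M, mdim N)) (f : 'M[F]_(mdim P, mdim N)),
    ishom g -> row_full g -> ishom f ->
    exists h : 'M[F]_(mdim P, mdim M), ishom h /\ h *m g = f.

Definition injective (I : amod) :=
  forall (M N : amod) (g : 'M[F]_(mdim N, mdim M)) (f : 'M[F]_(mdim N, mdim I)),
    ishom g -> row_free g -> ishom f ->
    exists h : 'M[F]_(mdim M, mdim I), ishom h /\ g *m h = f.

Definition proj_cover (P L : amod) :=
  projective P /\
  exists p : 'M[F]_(mdim P, mdim L), [/\ ishom p, row_full p &
    forall W : 'M[F]_(mdim P), submod W -> (W + kermx p == 1%:M)%MS -> (W == 1%:M)%MS].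

Definition inj_env (L I : amod) :=
  injective I /\
  exists j : 'M[F]_(mdim L, mdim I), [/\ ishom j, row_free j &
    forall W : 'M[F]_(mdim I), submod W -> \rank W <> 0%N -> \rank (W :&: j)%MS <> 0%N].

Definition simple_labeling (n : nat) (L : 'I_n -> amod) :=
  [/\ forall i, simple (L i),
      forall i j, mod_iso (L i) (L j) -> i = j &
      forall S, simple S -> exists i, mod_iso S (L i)].

Section Labeled.
Variables (n : nat) (L : 'I_n -> amod).

Definition trace_gen (lam : 'I_n) (P : amod) (V : 'M[F]_(mdim P)) :=
  forall (mu : 'I_n), (lam < mu)%N ->
  forall (Q : amod) (f : 'M[F]_(mdim Q, mdim P)),
    proj_cover Q (L mu) -> ishom f -> (f <= V)%MS.

(* U = Trace_{P^{>lam}}(P) : the sum of all such images *)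
Definition is_trace (lam : 'I_n) (P : amod) (U : 'M[F]_(mdim P)) :=
  trace_gen lam U /\ forall V, trace_gen lam V -> (U <= V)%MS.

Definition is_std (lam : 'I_n) (D : amod) :=
  exists P : amod, proj_cover P (L lam) /\
  exists (U : 'M[F]_(mdim P)) (q : 'M[F]_(mdim P, mdim D)),
    [/\ is_trace lam U, ishom q, row_full q & (kermx q == U)%MS].

Definition pcostd_cond (lam : 'I_n) (I : amod) (V : 'M[F]_(mdim I)) :=
  submod V /\
  exists l s, chain (M := I) 0 V l s /\
  exists i0, [/\ (i0 < l)%N, subquot (s i0) (s i0.+1) (L lam) &
    forall i, (i < l)%N -> i <> i0 ->
      exists mu : 'I_n, (mu < lam)%N /\ subquot (s i) (s i.+1) (L mu)].

Definition is_pcostd (lam : 'I_n) (N : amod) :=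
  exists I : amod, inj_env (L lam) I /\
  exists V : 'M[F]_(mdim I), [/\ pcostd_cond lam V,
    forall W, pcostd_cond lam W -> (W <= V)%MS &
    subquot (M := I) 0 V N].

Definition inFDelta (M : amod) := inF (fun X => exists lam, is_std lam X) M.
Definition inFpnabla (M : amod) := inF (fun X => exists lam, is_pcostd lam X) M.

End Labeled.

(* exact sequence 0 -> X l -> ... -> X 0 -> N -> 0 with all X i in C,
   maps f i : X (i+1) -> X i and f0 : X 0 -> N *)
Definition has_res (C : amod -> Prop) (N : amod) (l : nat) :=
  exists (X : nat -> amod)
         (f : forall i, 'M[F]_(mdim (X i.+1), mdim (X i)))
         (f0 : 'M[F]_(mdim (X 0), mdim N)),
  [/\ forall i, (i <= l)%N -> C (X i),
      (forall i, ishom (f i)) /\ ishom f0,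
      row_full f0,
      ((0 < l)%N -> (f 0 == kermx f0)%MS) /\
      (forall i, (i.+1 < l)%N -> (f i.+1 == kermx (f i))%MS) &
      (l = 0%N -> row_free f0) /\ (forall i, l = i.+1 -> row_free (f i))].

Definition Delta_dim n (L : 'I_n -> amod) (N : amod) (l : nat) :=
  has_res (inFDelta L) N l /\ forall l', has_res (inFDelta L) N l' -> (l <= l')%N.

Definition pdim (N : amod) (p : nat) :=
  has_res projective N p /\ forall p', has_res projective N p' -> (p <= p')%N.

Definition fdimDelta_le n (L : 'I_n -> amod) (k : nat) :=
  forall N l, Delta_dim L N l -> (l <= k)%N.

Definition fdim_le (k : nat) := forall N p, pdim N p -> (p <= k)%N.

Definition pdim_le (N : amod) (t : nat) := exists p, pdim N p /\ (p <= t)%N.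

(* M in add(T) = Add(T) (finite-dimensional setting): M is a direct summand
   of T^m for some m *)
Definition in_add (T M : amod) :=
  exists (m : nat) (i : 'I_m -> 'M[F]_(mdim M, mdim T))
         (p : 'I_m -> 'M[F]_(mdim T, mdim M)),
  [/\ forall k, ishom (i k), forall k, ishom (p k) &
      \sum_(k < m) (i k *m p k) = 1%:M].

Definition basic (T : amod) :=
  forall (X : amod) (i1 i2 : 'M[F]_(mdim X, mdim T)) (p1 p2 : 'M[F]_(mdim T, mdim X)),
    ishom i1 -> ishom i2 -> ishom p1 -> ishom p2 ->
    i1 *m p1 = 1%:M -> i2 *m p2 = 1%:M -> i1 *m p2 = 0 -> i2 *m p1 = 0 ->
    mdim X = 0%N.

Definition char_tilting n (L : 'I_n -> amod) (T : amod) :=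
  basic T /\ forall M, in_add T M <-> (inFDelta L M /\ inFpnabla L M).

Definition regfun (a : A) (v : 'rV[F]_(dim A)) : 'rV[F]_(dim A) :=
  v2r (a * r2v v).
Definition regact (a : A) : 'M[F]_(dim A) := lin1_mx (regfun a).

Lemma mul_regact (a : A) u : u *m regact a = regfun a u.
Proof.
rewrite [u in LHS]row_sum_delta mulmx_suml.
rewrite [u in RHS]row_sum_delta /regfun linear_sum /= mulr_sumr linear_sum /=.
apply: eq_bigr => j _; rewrite -scalemxAl linearZ /= -scalerAr linearZ /=.
by congr (_ *: _); rewrite /regact -rowE; apply/rowP => k; rewrite !mxE.
Qed.

Lemma eq_mx_rV m (M N : 'M[F]_m) : (forall u : 'rV[F]_m, u *m M = u *m N) -> M = N.
Proof. by move=> H; apply/row_matrixP => i; rewrite !rowE H. Qed.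

Lemma regact_lin (k : F) (a b : A) : regact (k *: a + b) = k *: regact a + regact b.
Proof.
apply: eq_mx_rV => u; rewrite mulmxDr -scalemxAr !mul_regact /regfun.
by rewrite mulrDl -scalerAl linearD linearZ.
Qed.

Lemma regact1 : regact 1 = 1%:M.
Proof. by apply: eq_mx_rV => u; rewrite mul_regact mulmx1 /regfun mul1r r2vK. Qed.

Lemma regactM a b : regact (a * b) = regact b *m regact a.
Proof.
apply: eq_mx_rV => u; rewrite mulmxA !mul_regact /regfun v2rK.
by rewrite mulrA.
Qed.

Definition regmod : amod := AMod regact_lin regact1 regactM.

Definition SSS n (L : 'I_n -> amod) := inFDelta L regmod.

End Modules.

(* Main.v *)
From HB Require Import structures.
From mathcomp Require Import all_boot all_algebra all_field.
From Stdlib Require Import Classical.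
Require Import Defs.
Set Implicit Arguments. Unset Strict Implicit. Unset Printing Implicit Defensive.
Import GRing.Theory.
Import VectorInternalTheory.
Local Open Scope ring_scope.

(* Projectives lie in F(Delta), so a module N of finite projective dimension has a
   Delta-resolution of length l <= fdim_Delta, and shifting dimensions along it gives
   pd N <= l + pd F(Delta).  It remains to bound pd Delta(lam) by pd T: iterated universal
   extensions by Delta(mu), mu < lam, embed Delta(lam) in a module of
   F(Delta) /\ F(nabla-bar) = add T with cokernel in F(Delta(mu) : mu < lam), and one
   inducts on lam.
   The homological input is Ext^1(Delta, nabla-bar) = Ext^2(Delta, nabla-bar) = 0 together
   with the characterisations of F(Delta) and F(nabla-bar) as the modules that are
   Ext^1-orthogonal to the nabla-bar and to the Delta.  Ext^2 vanishes because the kernel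
   of P(lam) -> Delta(lam), a trace, is a direct summand of the corresponding trace of A,
   which is again filtered by standard modules. *)

(* No correction term arises because each standard module appears as a kernel: in 0 -> Delta(lam) ->
   T' -> Z -> 0 the bounds pd T' <= t and pd Z <= t already give pd Delta(lam) <= t, so the
   induction on lam accumulates no shifts. Ext^2(Delta, nabla-bar) = 0 is what lets the two
   characterisations proceed by splitting off one layer: it keeps the kernel of X -> Delta(lam), or
   the cokernel of nabla-bar(lam) -> Y, orthogonal. Proper costandard modules make the label bounds
   fit: rad Delta(lam) may contain L(lam) again, whereas nabla-bar(lam)/L(lam) has only factors
   below lam. No Ext groups are formed. Vanishing of Ext^1 is an extension property of maps, Ext^2
   is moved onto a syzygy or cosyzygy, and every long exact sequence becomes a short chase. *)
Reserved Notation "M ~> N" (at level 99, no associativity).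

(** * Linear algebra of row spaces, kernels and ranks *)

Section Linear.
Variable F : fieldType.

Lemma eq_mx_cV m n (M N : 'M[F]_(m, n)) :
  (forall v : 'rV[F]_n, M *m v^T = N *m v^T) -> M = N.
Proof.
move=> H; apply: trmx_inj; apply/row_matrixP => i.
by rewrite !rowE; apply: trmx_inj; rewrite !trmx_mul !trmxK H.
Qed.

Lemma kermx_subP m n p (f : 'M[F]_(m, n)) (g : 'M[F]_(m, p)) :
  (kermx f <= kermx g)%MS -> exists h, f *m h = g.
Proof.
move=> H; exists (pinvmx f *m g).
have E : (1%:M - f *m pinvmx f) *m f = 0.
  by rewrite mulmxBl mul1mx mulmxKpV ?submx_refl ?subrr.
have /submx_trans/(_ H) : ((1%:M - f *m pinvmx f) <= kermx f)%MS by apply/sub_kermxP.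
by move/sub_kermxP/eqP; rewrite mulmxBl mul1mx subr_eq0 mulmxA => /eqP.
Qed.

(** Ranks are bounded by [m], so induction on the deficit [m - \rank U] takes the place of Zorn's
    lemma; [P] is an arbitrary proposition, hence the classical case split. *)
Lemma ex_maxrank m (P : 'M[F]_m -> Prop) :
  (exists U, P U) -> exists2 U, P U & forall W, P W -> (\rank W <= \rank U)%N.
Proof.
case=> U0 PU0; suff H d : forall U, P U -> (m - \rank U <= d)%N ->
    exists2 U, P U & forall W, P W -> (\rank W <= \rank U)%N.
  by apply: (H _ U0 PU0 (leqnn _)).
elim: d => [|d IH] U PU.
  rewrite leqn0 subn_eq0 => le; exists U => // W _.
  by apply: leq_trans le; apply: rank_leq_row.
move=> led.
case: (classic (exists2 W, P W & (\rank U < \rank W)%N)) => [[W PW lt]|nex].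
  apply: (IH W PW); rewrite -ltnS; apply: leq_trans led.
  by rewrite ltn_sub2l ?(leq_trans lt) ?rank_leq_row.
exists U => // W PW; rewrite leqNgt; apply/negP => lt.
by apply: nex; exists W.
Qed.

End Linear.

(** * Modules, short exact sequences, enough projectives *)

Section Abelian.
Variables (F : fieldType) (A : falgType F).
Implicit Types (M N X Y Z K P E : amod A).
Local Notation "M ~> N" := 'M[F]_(mdim M, mdim N) : type_scope.

HB.instance Definition _ M := GRing.isLinear.Build F A _ *:%R (@mact F A M) (@mact_lin F A M).

Lemma hom0 M N : ishom (0 : M ~> N).
Proof. by move=> a; rewrite mulmx0 mul0mx. Qed.
Lemma hom1 M : @ishom F A M M 1%:M.
Proof. by move=> a; rewrite mulmx1 mul1mx. Qed.
Lemma homM M N P (f : M ~> N) (g : N ~> P) : ishom f -> ishom g -> ishom (f *m g).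
Proof. by move=> hf hg a; rewrite mulmxA hf -!mulmxA hg. Qed.
Lemma homD M N (f g : M ~> N) : ishom f -> ishom g -> ishom (f + g).
Proof. by move=> hf hg a; rewrite mulmxDr mulmxDl hf hg. Qed.
Lemma homN M N (f : M ~> N) : ishom f -> ishom (- f).
Proof. by move=> hf a; rewrite mulmxN mulNmx hf. Qed.
Lemma homB M N (f g : M ~> N) : ishom f -> ishom g -> ishom (f - g).
Proof. by move=> hf hg; apply/homD/homN. Qed.
Lemma homZ M N c (f : M ~> N) : ishom f -> ishom (c *: f).
Proof. by move=> hf a; rewrite -scalemxAr -scalemxAl hf. Qed.
Lemma hom_sum M N I (r : seq I) (f : I -> (M ~> N)) :
  (forall i, ishom (f i)) -> ishom (\sum_(i <- r) f i).
Proof. by move=> h; apply: big_ind => //; [exact: hom0 | exact: homD]. Qed.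

Lemma row_free_cancel m n p (i : 'M[F]_(n, p)) (f g : 'M[F]_(m, n)) :
  row_free i -> f *m i = g *m i -> f = g.
Proof. by move=> /row_free_inj; apply. Qed.
Lemma row_full_cancel m n p (q : 'M[F]_(m, n)) (f g : 'M[F]_(n, p)) :
  row_full q -> q *m f = q *m g -> f = g.
Proof. by move=> /row_full_inj; apply. Qed.

Lemma hom_factor_mono M N P (i : N ~> P) (f : M ~> P) :
  ishom i -> row_free i -> ishom f -> (f <= i)%MS ->
  exists2 g : M ~> N, ishom g & g *m i = f.
Proof.
move=> hi ri hf /submxP[g fE]; exists g => // a.
by apply: (row_free_cancel ri); rewrite -!mulmxA hi -fE hf fE mulmxA.
Qed.

Lemma hom_factor_epi M N P (q : M ~> N) (f : M ~> P) :
  ishom q -> row_full q -> ishom f -> (kermx q <= kermx f)%MS ->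
  exists2 g : N ~> P, ishom g & q *m g = f.
Proof.
move=> hq rq hf /kermx_subP[g fE]; exists g => // a.
by apply: (row_full_cancel rq); rewrite mulmxA -hq -mulmxA fE hf -fE mulmxA.
Qed.

(** Vectors are rows, so [i *m p] is [i] followed by [p], and [row_free], [row_full] mean injective,
    surjective. One inclusion suffices for exactness, the other being [ses_comp]. *)
Record ses X E Y (i : X ~> E) (p : E ~> Y) : Prop := Ses {
  ses_homl : ishom i; ses_homr : ishom p; ses_mono : row_free i;
  ses_epi : row_full p; ses_comp : i *m p = 0; ses_exact : (kermx p <= i)%MS }.

Lemma ses_factorl X E Y (i : X ~> E) (p : E ~> Y) M (f : M ~> E) :
  ses i p -> ishom f -> f *m p = 0 -> exists2 g : M ~> X, ishom g & g *m i = f.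
Proof.
case=> hi hp ri rp _ ex hf /sub_kermxP fp.
by apply: hom_factor_mono => //; apply: submx_trans fp ex.
Qed.

Lemma ses_factorr X E Y (i : X ~> E) (p : E ~> Y) M (f : E ~> M) :
  ses i p -> ishom f -> i *m f = 0 -> exists2 g : Y ~> M, ishom g & p *m g = f.
Proof.
case=> hi hp ri rp _ ex hf /sub_kermxP fi.
by apply: hom_factor_epi => //; apply: submx_trans ex fi.
Qed.

Lemma ses_dim X E Y (i : X ~> E) (p : E ~> Y) : ses i p -> mdim E = (mdim X + mdim Y)%N.
Proof.
case=> _ _ /eqP ri /eqP rp ip ex.
have /eqP : \rank (kermx p) = \rank i.
  by apply/eqP; rewrite eqn_leq !mxrankS //; apply/sub_kermxP.
by rewrite mxrank_ker ri rp => /eqP <-; rewrite subnK // -{1}rp rank_leq_row.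
Qed.

Lemma submod_imP m M (u : 'M[F]_(m, mdim M)) :
  (forall a, (u *m mact M a <= u)%MS) -> submod (M := M) <<u>>%MS.
Proof. by move=> H a; rewrite (eqmxMr _ (genmxE u)) genmxE. Qed.

Lemma hom_im M N (f : M ~> N) : ishom f -> submod (M := N) <<f>>%MS.
Proof. by move=> hf; apply: submod_imP => a; rewrite -hf submxMl. Qed.

Lemma hom_ker M N (f : M ~> N) : ishom f -> submod (M := M) (kermx f).
Proof. by move=> hf a; apply/sub_kermxP; rewrite -mulmxA hf mulmxA mulmx_ker mul0mx. Qed.

Lemma submod_cap M (U V : 'M[F]_(mdim M)) : submod U -> submod V -> submod (U :&: V)%MS.
Proof.
by move=> hU hV a; rewrite sub_capmx !(submx_trans _ (hU a), submx_trans _ (hV a)) // submxMr ?capmxSl ?capmxSr.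
Qed.

Lemma submod_add M (U V : 'M[F]_(mdim M)) : submod U -> submod V -> submod (U + V)%MS.
Proof. by move=> hU hV a; rewrite addsmxMr addsmxS. Qed.

Lemma submod_im M N (f : M ~> N) (U : 'M[F]_(mdim M)) :
  ishom f -> submod U -> submod (M := N) <<U *m f>>%MS.
Proof.
by move=> hf hU; apply: submod_imP => a; rewrite -mulmxA -hf mulmxA submxMr.
Qed.

Lemma subobj M (U : 'M[F]_(mdim M)) : submod U ->
  exists X (i : X ~> M), [/\ ishom i, row_free i & (i :=: U)%MS].
Proof.
move=> hU; set i := row_base U.
have ri : row_free i by apply: row_base_free.
have iU : (i :=: U)%MS by apply: eq_row_base.
move: i ri iU => i ri iU.
pose act a := i *m mact M a *m pinvmx i.
have actE a : act a *m i = i *m mact M a.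
  by rewrite mulmxKpV // iU; apply: submx_trans (hU a); rewrite submxMr ?iU.
have lin k a b : act (k *: a + b) = k *: act a + act b.
  by apply: (row_free_cancel ri); rewrite mulmxDl -scalemxAl !actE linearP mulmxDr -scalemxAr.
have act1 : act 1 = 1%:M.
  by apply: (row_free_cancel ri); rewrite actE mact1 mulmx1 mul1mx.
have actM a b : act (a * b) = act b *m act a.
  by apply: (row_free_cancel ri); rewrite -mulmxA !actE mactM !mulmxA actE.
by exists (AMod lin act1 actM), i; split=> // a.
Qed.

Lemma quoobj M (U : 'M[F]_(mdim M)) : submod U ->
  exists X (q : M ~> X), [/\ ishom q, row_full q & (kermx q :=: U)%MS].
Proof.
move=> hU; set q := col_base (cokermx U).
have rq : row_full q by apply: col_base_full.
have qU : (kermx q :=: U)%MS.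
  apply/eqmxP/andP; split.
    apply/rV_subP => v /sub_kermxP vq; rewrite submxE.
    by rewrite -(mulmx_base (cokermx U)) mulmxA vq mul0mx.
  apply/sub_kermxP; apply: (@row_free_cancel _ _ _ (row_base (cokermx U))).
    exact: row_base_free.
  by rewrite -mulmxA mulmx_base mulmx_coker mul0mx.
move: q rq qU => q rq qU.
have [pq qK] : exists pq, q *m pq *m q = q by exists (pinvmx q); rewrite mulmxKpV.
pose act a := pq *m mact M a *m q.
have actE a : q *m act a = mact M a *m q.
  have /kermx_subP[h hE] : (kermx q <= kermx (mact M a *m q))%MS.
    apply/sub_kermxP; rewrite mulmxA; apply/sub_kermxP.
    by rewrite qU (submx_trans _ (hU a)) // submxMr // qU.
  by rewrite /act -mulmxA -hE !mulmxA qK.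
have lin k a b : act (k *: a + b) = k *: act a + act b.
  by apply: (row_full_cancel rq); rewrite mulmxDr -scalemxAr !actE linearP mulmxDl -scalemxAl.
have act1 : act 1 = 1%:M.
  by apply: (row_full_cancel rq); rewrite actE mact1 mulmx1 mul1mx.
have actM a b : act (a * b) = act b *m act a.
  by apply: (row_full_cancel rq); rewrite mulmxA !actE mactM -!mulmxA actE.
by exists (AMod lin act1 actM), q; split=> // a.
Qed.

Lemma row_free_comp m n p (f : 'M[F]_(m, n)) (g : 'M[F]_(n, p)) :
  row_free f -> row_free g -> row_free (f *m g).
Proof. by rewrite /row_free => /eqP rf rg; rewrite mxrankMfree ?rf. Qed.

Lemma row_full_comp m n p (f : 'M[F]_(m, n)) (g : 'M[F]_(n, p)) :
  row_full f -> row_full g -> row_full (f *m g).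
Proof.
move=> /row_fullP[f' f'E] /row_fullP[g' g'E]; apply/row_fullP; exists (g' *m f').
by rewrite -mulmxA (mulmxA f') f'E mul1mx.
Qed.

Lemma ker_ses M N (p : M ~> N) : ishom p -> row_full p ->
  exists K (i : K ~> M), ses i p.
Proof.
move=> hp rp; have [K [i [hi ri iU]]] := subobj (hom_ker hp).
by exists K, i; split=> //; [apply/sub_kermxP|]; rewrite iU.
Qed.

(** [K2] is the preimage of [X] under [q], so it is at once the kernel of the composite onto [Y] and
    an extension of [X] by [K]. *)
Lemma ses_pull K Q E X Y (k : K ~> Q) (q : Q ~> E) (i : X ~> E) (p : E ~> Y) :
  ses k q -> ses i p ->
  exists K2 (k2 : K2 ~> Q) (k' : K ~> K2) (q' : K2 ~> X),
    [/\ ses k2 (q *m p), ses k' q', k' *m k2 = k & q' *m i = k2 *m q].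
Proof.
move=> Sk S.
have [K2 [k2 S2]] := ker_ses (homM (ses_homr Sk) (ses_homr S)) (row_full_comp (ses_epi Sk) (ses_epi S)).
have [|k' hk' k'E] := ses_factorl S2 (ses_homl Sk).
  by rewrite mulmxA (ses_comp Sk) mul0mx.
have [|q' hq' q'E] := ses_factorl S (homM (ses_homl S2) (ses_homr Sk)).
  by rewrite -mulmxA (ses_comp S2).
exists K2, k2, k', q'; split=> //; split=> //.
- by apply/row_freeP; have /row_freeP[c cE] := ses_mono Sk; exists (k2 *m c); rewrite mulmxA k'E.
- have /submxP[v vE] : (i <= q)%MS by apply: submx_full; apply: ses_epi Sk.
  have /sub_kermxP/submx_trans/(_ (ses_exact S2))/submxP[w wE] : v *m (q *m p) = 0.
    by rewrite mulmxA -vE (ses_comp S).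
  apply/row_fullP; exists w; apply: (row_free_cancel (ses_mono S)).
  by rewrite -mulmxA q'E mulmxA -wE -vE mul1mx.
- by apply: (row_free_cancel (ses_mono S)); rewrite -mulmxA q'E mulmxA k'E (ses_comp Sk) mul0mx.
have /sub_kermxP/submx_trans/(_ (ses_exact Sk))/submxP[u uE] : kermx q' *m k2 *m q = 0.
  by rewrite -mulmxA -q'E mulmxA mulmx_ker mul0mx.
have -> : kermx q' = u *m k' by apply: (row_free_cancel (ses_mono S2)); rewrite uE -mulmxA k'E.
exact: submxMl.
Qed.

Lemma coker_ses M N (i : M ~> N) : ishom i -> row_free i ->
  exists Q (p : N ~> Q), ses i p.
Proof.
move=> hi ri; have [Q [p [hp rp pU]]] := quoobj (hom_im hi).
by exists Q, p; split=> //; [apply/sub_kermxP|]; rewrite pU genmxE.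
Qed.

Lemma im_factor M N (f : M ~> N) : ishom f ->
  exists I (q : M ~> I) (i : I ~> N),
    [/\ ishom q, ishom i, row_full q, row_free i & f = q *m i].
Proof.
move=> hf; have [I [i [hi ri iU]]] := subobj (hom_im hf).
have [|q hq qi] := hom_factor_mono hi ri hf; first by rewrite iU genmxE.
exists I, q, i; split=> //.
have /submxP[d dE] : (i <= f)%MS by rewrite iU genmxE.
have dq : d *m q = 1%:M.
  by apply: (row_free_cancel ri); rewrite -mulmxA qi -dE mul1mx.
by rewrite -sub1mx -dq submxMl.
Qed.

Lemma mono_kerP m n (f : 'M[F]_(m, n)) :
  (forall v : 'rV_m, v *m f = 0 -> v = 0) -> row_free f.
Proof.
move=> H; rewrite -kermx_eq0; apply/eqP/row_matrixP => i.
by rewrite row0; apply: H; rewrite -row_mul mulmx_ker row0.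
Qed.

Definition dsact M N a := block_mx (mact M a) 0 0 (mact N a).
Lemma dsact_lin M N k a b : dsact M N (k *: a + b) = k *: dsact M N a + dsact M N b.
Proof. by rewrite /dsact !linearP scale_block_mx add_block_mx !scaler0 !addr0. Qed.
Lemma dsact1 M N : dsact M N 1 = 1%:M.
Proof. by rewrite /dsact !mact1 -scalar_mx_block. Qed.
Lemma dsactM M N a b : dsact M N (a * b) = dsact M N b *m dsact M N a.
Proof. by rewrite /dsact !mactM mulmx_block !mulmx0 !mul0mx !addr0 !add0r. Qed.
Definition dsum M N := AMod (@dsact_lin M N) (@dsact1 M N) (@dsactM M N).

Lemma hom_row P M N (f : P ~> M) (g : P ~> N) :
  ishom f -> ishom g -> @ishom F A P (dsum M N) (row_mx f g).
Proof.
move=> hf hg a; rewrite mul_mx_row /= /dsact.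
by rewrite mul_row_block !mulmx0 addr0 add0r hf hg.
Qed.
Lemma hom_col P M N (f : M ~> P) (g : N ~> P) :
  ishom f -> ishom g -> @ishom F A (dsum M N) P (col_mx f g).
Proof.
move=> hf hg a; rewrite /= /dsact [RHS]mul_col_mx.
by rewrite mul_block_col !mul0mx addr0 add0r hf hg.
Qed.

Definition dinl M N : M ~> dsum M N := row_mx 1%:M 0.
Definition dinr M N : N ~> dsum M N := row_mx 0 1%:M.
Definition dprl M N : dsum M N ~> M := col_mx 1%:M 0.
Definition dprr M N : dsum M N ~> N := col_mx 0 1%:M.

Lemma dinlE M N P (f : M ~> P) (g : N ~> P) : dinl M N *m (col_mx f g : dsum M N ~> P) = f.
Proof. by rewrite /dinl mul_row_col mul1mx mul0mx addr0. Qed.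
Lemma dprlE M N P (f : P ~> M) (g : P ~> N) : (row_mx f g : P ~> dsum M N) *m dprl M N = f.
Proof. by rewrite /dprl mul_row_col mulmx1 mulmx0 addr0. Qed.
Lemma dprrE M N P (f : P ~> M) (g : P ~> N) : (row_mx f g : P ~> dsum M N) *m dprr M N = g.
Proof. by rewrite /dprr mul_row_col mulmx1 mulmx0 add0r. Qed.
Lemma hom_dinl M N : ishom (dinl M N). Proof. apply: hom_row; [exact: hom1|exact: hom0]. Qed.
Lemma hom_dinr M N : ishom (dinr M N). Proof. apply: hom_row; [exact: hom0|exact: hom1]. Qed.
Lemma hom_dprl M N : ishom (dprl M N). Proof. apply: hom_col; [exact: hom1|exact: hom0]. Qed.
Lemma hom_dprr M N : ishom (dprr M N). Proof. apply: hom_col; [exact: hom0|exact: hom1]. Qed.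

Lemma col_prE M N P (f : M ~> P) (g : N ~> P) : (col_mx f g : dsum M N ~> P) = dprl M N *m f + dprr M N *m g.
Proof. by rewrite /dprl /dprr !mul_col_mx !mul1mx !mul0mx add_col_mx addr0 add0r. Qed.
Lemma row_inE M N P (f : P ~> M) (g : P ~> N) : (row_mx f g : P ~> dsum M N) = f *m dinl M N + g *m dinr M N.
Proof. by rewrite /dinl /dinr !mul_mx_row !mulmx1 !mulmx0 add_row_mx addr0 add0r. Qed.

Lemma projective_dsum M N : projective M -> projective N -> projective (dsum M N).
Proof.
move=> pM pN X Y g f hg rg hf.
have [h1 [hh1 e1]] := pM _ _ g (dinl M N *m f) hg rg (homM (@hom_dinl _ _) hf).
have [h2 [hh2 e2]] := pN _ _ g (dinr M N *m f) hg rg (homM (@hom_dinr _ _) hf).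
exists (col_mx h1 h2); split; first exact: hom_col.
rewrite mul_col_mx e1 e2 -[RHS]vsubmxK /dinl /dinr -{1 2}[f]vsubmxK !mul_row_col.
by rewrite !mul1mx !mul0mx addr0 add0r.
Qed.

Lemma injective_dsum M N : injective M -> injective N -> injective (dsum M N).
Proof.
move=> pM pN X Y g f hg rg hf.
have [h1 [hh1 e1]] := pM _ _ g (f *m dprl M N) hg rg (homM hf (@hom_dprl _ _)).
have [h2 [hh2 e2]] := pN _ _ g (f *m dprr M N) hg rg (homM hf (@hom_dprr _ _)).
exists (row_mx h1 h2); split; first exact: hom_row.
rewrite mul_mx_row e1 e2 -[RHS]hsubmxK /dprl /dprr -{1 2}[f]hsubmxK !mul_row_col.
by rewrite !mulmx1 !mulmx0 addr0 add0r.
Qed.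

(** The map a |-> a.x from the adjunction Hom_A(A, M) = M; row [j] is the image of the [j]-th basis
    vector of [A]. *)
Definition freehom M (x : 'rV[F]_(mdim M)) : regmod A ~> M :=
  \matrix_(j < dim A) (x *m mact M (r2v (delta_mx 0 j))).

Lemma freehomE M (x : 'rV_(mdim M)) (v : 'rV_(dim A)) : v *m freehom x = x *m mact M (r2v v).
Proof.
have -> : r2v v = \sum_j v 0 j *: r2v (delta_mx 0 j) :> A.
  by rewrite {1}[v]row_sum_delta linear_sum; apply: eq_bigr => j _; rewrite linearZ.
rewrite linear_sum /= mulmx_sumr {1}[v]row_sum_delta mulmx_suml.
by apply: eq_bigr => j _; rewrite -scalemxAl linearZ /= -scalemxAr -rowE rowK.
Qed.

Lemma hom_free M (x : 'rV_(mdim M)) : ishom (freehom x).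
Proof.
move=> a; apply/row_matrixP => i; rewrite !rowE !mulmxA freehomE mul_regact freehomE.
by rewrite v2rK mactM mulmxA.
Qed.

Lemma freehom1 M (x : 'rV_(mdim M)) : v2r 1 *m freehom x = x.
Proof. by rewrite freehomE v2rK mact1 mulmx1. Qed.

Lemma freehom_uniq M (f : regmod A ~> M) : ishom f -> f = freehom (v2r 1 *m f).
Proof.
move=> hf; apply/row_matrixP => i; rewrite !rowE freehomE -mulmxA -hf mulmxA mul_regact.
by rewrite /regfun v2rK mulr1 r2vK.
Qed.

Lemma projective_regmod : projective (regmod A).
Proof.
move=> M N g f hg rg hf.
have /submxP[y yE] : (v2r 1 *m f <= g)%MS by apply: submx_full.
exists (freehom y); split; first exact: hom_free.
rewrite [RHS](freehom_uniq hf) [LHS](freehom_uniq (homM (hom_free _) hg)).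
by rewrite mulmxA freehom1 yE.
Qed.

Lemma submod0 M : submod (0 : 'M[F]_(mdim M)).
Proof. by move=> a; rewrite mul0mx sub0mx. Qed.

Lemma zero_module : exists Z : amod A, mdim Z = 0%N.
Proof.
have [Z [z [hz rz zU]]] := subobj (submod0 (regmod A)).
by exists Z; have := eqP rz; rewrite zU mxrank0.
Qed.

(** One copy of the regular module is added per coordinate of [M]: after [k] steps the first [k]
    unit vectors lie in the image. *)
Lemma enough_projectives (C : amod A -> Prop) :
  (forall M, mdim M = 0%N -> C M) -> C (regmod A) ->
  (forall M N, C M -> C N -> C (dsum M N)) ->
  forall M, exists P (p : P ~> M), [/\ projective P, C P, ishom p & row_full p].
Proof.
move=> C0 C1 CD M.
suff H k : exists P (p : P ~> M), [/\ projective P, C P, ishom p &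
    forall j : 'I_(mdim M), (j < k)%N -> ((delta_mx 0 j : 'rV_(mdim M)) <= p)%MS].
  have [P [p [pP CP hp sp]]] := H (mdim M).
  exists P, p; split=> //; rewrite -sub1mx; apply/row_subP => i.
  by rewrite row1 sp.
elim: k => [|k [P [p [pP CP hp sp]]]].
  have [Z Z0] := zero_module.
  exists Z, 0; split=> //; [|exact: C0|exact: hom0].
  move=> X Y g f _ _ _; exists 0; split; first exact: hom0.
  by apply/matrixP => i; exfalso; move: (i); rewrite Z0 => -[].
case: (ltnP k (mdim M)) => [lt|le]; last first.
  by exists P, p; split=> // j jk; apply: sp; apply: leq_trans le.
exists (dsum P (regmod A)), (col_mx p (freehom (delta_mx 0 (Ordinal lt)))).
split; [exact: projective_dsum projective_regmod|exact: CD|exact: hom_col (hom_free _)|].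
move=> j; rewrite ltnS leq_eqVlt -addsmxE => /orP[/eqP jk|/sp jk].
  apply: submx_trans (addsmxSr _ _).
  have -> : j = Ordinal lt by apply: val_inj.
  by rewrite -{1}[delta_mx _ _]freehom1 submxMl.
exact: submx_trans (addsmxSl _ _).
Qed.

Lemma enough_proj M : exists P (p : P ~> M), [/\ projective P, ishom p & row_full p].
Proof.
have [P [p [pP _ hp rp]]] := @enough_projectives (fun=> True) (fun _ _ => I) I (fun _ _ _ _ => I) M.
by exists P, p.
Qed.

End Abelian.

(** * Injective modules *)

Section Injectives.
Variables (F : fieldType) (A : falgType F).
Implicit Types (M N X Y Z K P E : amod A).
Local Notation "M ~> N" := 'M[F]_(mdim M, mdim N) : type_scope.

Definition rregact (a : A) : 'M[F]_(dim A) :=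
  \matrix_j v2r (r2v (delta_mx 0 j) * a).

Lemma mul_rregact a (v : 'rV[F]_(dim A)) : v *m rregact a = v2r (r2v v * a).
Proof.
rewrite {2}[v]row_sum_delta linear_sum /= mulr_suml linear_sum /=.
rewrite {1}[v]row_sum_delta mulmx_suml; apply: eq_bigr => j _.
by rewrite -scalemxAl linearZ /= -scalerAl linearZ /= -rowE rowK.
Qed.

Lemma dualact_lin k a b : (rregact (k *: a + b))^T = k *: (rregact a)^T + (rregact b)^T.
Proof.
rewrite -linearP; congr trmx; apply: eq_mx_rV => u.
by rewrite mulmxDr -scalemxAr !mul_rregact mulrDr -scalerAr linearD linearZ.
Qed.
Lemma dualact1 : (rregact 1)^T = 1%:M.
Proof.
rewrite -[RHS]trmx1; congr trmx; apply: eq_mx_rV => u.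
by rewrite mul_rregact mulr1 r2vK mulmx1.
Qed.
Lemma dualactM a b : (rregact (a * b))^T = (rregact b)^T *m (rregact a)^T.
Proof.
rewrite -trmx_mul; congr trmx; apply: eq_mx_rV => u.
by rewrite mulmxA !mul_rregact v2rK mulrA.
Qed.
(* The linear dual of the right regular module, functionals being row vectors of values. *)
Definition dualmod := AMod dualact_lin dualact1 dualactM.

(** The adjunction Hom_A(M, DA) = DM, with D the linear dual: [psi] is a functional on [M], and v
    goes to the functional a |-> psi(a.v), listed by its values on the basis of [A]. *)
Definition cofreehom M (psi : 'cV[F]_(mdim M)) : M ~> dualmod :=
  \matrix_(i, j) (mact M (r2v (delta_mx 0 j)) *m psi) i 0.

Lemma cofreehomE M (psi : 'cV_(mdim M)) (v : 'rV_(dim A)) :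
  cofreehom psi *m v^T = mact M (r2v v) *m psi.
Proof.
have -> : r2v v = \sum_j v 0 j *: r2v (delta_mx 0 j) :> A.
  by rewrite {1}[v]row_sum_delta linear_sum; apply: eq_bigr => j _; rewrite linearZ.
rewrite linear_sum /= mulmx_suml; apply/matrixP => i k.
rewrite ord1 !mxE summxE; apply: eq_bigr => j _.
by rewrite linearZ /= -scalemxAl [RHS]mxE [cofreehom _ _ _]mxE [v^T _ _]mxE mulrC.
Qed.

Lemma hom_cofree M (psi : 'cV_(mdim M)) : ishom (cofreehom psi).
Proof.
move=> a; apply: eq_mx_cV => v; rewrite -!mulmxA cofreehomE /= -trmx_mul.
by rewrite cofreehomE mul_rregact v2rK mactM mulmxA.
Qed.

Lemma cofreehom1 M (psi : 'cV_(mdim M)) : cofreehom psi *m (v2r 1)^T = psi.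
Proof. by rewrite cofreehomE v2rK mact1 mul1mx. Qed.

Lemma cofreehom_uniq M (f : M ~> dualmod) : ishom f -> f = cofreehom (f *m (v2r 1)^T).
Proof.
move=> hf; apply: eq_mx_cV => v; rewrite cofreehomE mulmxA hf -mulmxA -trmx_mul.
by rewrite mul_rregact v2rK mul1r r2vK.
Qed.

Lemma injective_dualmod : injective dualmod.
Proof.
move=> M N g f hg rg hf.
have [psi psiE] : exists psi : 'cV_(mdim M), g *m psi = f *m (v2r 1)^T.
  apply: kermx_subP; rewrite (_ : kermx g = 0) ?sub0mx //.
  by apply/eqP; rewrite kermx_eq0.
exists (cofreehom psi); split; first exact: hom_cofree.
rewrite [RHS](cofreehom_uniq hf) [LHS](cofreehom_uniq (homM hg (hom_cofree _))).
by rewrite -mulmxA cofreehom1 psiE.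
Qed.

Lemma enough_inj M : exists I (p : M ~> I), [/\ injective I, ishom p & row_free p].
Proof.
suff H k : exists I (p : M ~> I), [/\ injective I, ishom p &
    forall v : 'rV_(mdim M), v *m p = 0 -> forall j : 'I_(mdim M), (j < k)%N -> v 0 j = 0].
  have [P [p [pP hp sp]]] := H (mdim M).
  exists P, p; split=> //; apply: mono_kerP => v v0; apply/rowP => j.
  by rewrite (sp _ v0) ?mxE.
elim: k => [|k [P [p [pP hp sp]]]].
  have [Z Z0] := @zero_module F A.
  exists Z, 0; split=> //; last exact: hom0.
  move=> X Y g f _ _ _; exists 0; split; first exact: hom0.
  by apply/matrixP => i j; exfalso; move: (j); rewrite Z0 => -[].
case: (ltnP k (mdim M)) => [lt|le]; last first.
  by exists P, p; split=> // v v0 j jk; apply: sp => //; apply: leq_trans le.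
exists (dsum P dualmod), (row_mx p (cofreehom (delta_mx (Ordinal lt) 0))).
split; [exact: injective_dsum injective_dualmod|exact: hom_row (hom_cofree _)|].
move=> v; rewrite mul_mx_row => v0 j.
have [v1 v2] : v *m p = 0 /\ v *m cofreehom (delta_mx (Ordinal lt) 0) = 0.
  by apply: eq_row_mx; rewrite v0 row_mx0.
rewrite ltnS leq_eqVlt => /orP[/eqP jk|/(sp _ v1)//].
have -> : j = Ordinal lt by apply: val_inj.
have /matrixP/(_ 0 0) : v *m delta_mx (Ordinal lt) 0 = 0 :> 'M_1.
  by rewrite -[delta_mx _ _]cofreehom1 mulmxA v2 mul0mx.
by rewrite -colE !mxE.
Qed.

End Injectives.

(** * Vanishing of extensions and projective dimension *)

Section Ext.
Variables (F : fieldType) (A : falgType F).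
Implicit Types (M N X Y Z K P E : amod A).
Local Notation "M ~> N" := 'M[F]_(mdim M, mdim N) : type_scope.

(* Ext^1(X, N) = 0. *)
Definition ext0 X N := forall K E (i : K ~> E) (p : E ~> X), ses i p ->
  forall f : K ~> N, ishom f -> exists2 g : E ~> N, ishom g & i *m g = f.

(** One projective presentation decides Ext^1. Any other extension of [X] receives a lift [h] of [p]
    and is then the pushout of its own kernel and [P] along [K], so maps on the two pieces that
    agree on [K] glue. *)
Lemma ext0_pres K P X N (i : K ~> P) (p : P ~> X) : ses i p -> projective P ->
  (forall f : K ~> N, ishom f -> exists2 g : P ~> N, ishom g & i *m g = f) ->
  ext0 X N.
Proof.
move=> S pP ext K' E i' p' S' f hf.
have [h [hh hE]] := pP _ _ p' p (ses_homr S') (ses_epi S') (ses_homr S).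
have [|k hk kE] := ses_factorl S' (homM (ses_homl S) hh).
  by rewrite -mulmxA hE (ses_comp S).
have [phi hphi phiE] := ext _ (homM hk hf).
have rq : row_full (col_mx i' h : dsum K' P ~> E).
  rewrite -sub1mx -addsmxE; apply/rV_subP => v _.
  have /submxP[w wE] : (v *m p' <= p)%MS by apply: submx_full; apply: ses_epi S.
  rewrite -[v](subrK (w *m h)) addmx_sub_adds ?submxMl //.
  apply: submx_trans (ses_exact S'); apply/sub_kermxP.
  by rewrite mulmxBl -mulmxA hE wE subrr.
have [|g hg gE] := hom_factor_epi (hom_col (ses_homl S') hh) rq (hom_col hf hphi).
  apply/rV_subP => v /sub_kermxP; rewrite -[v]hsubmxK.
  move: (lsubmx v) (rsubmx v) => v1 v2 /= v0.
  apply/sub_kermxP; move: v0; rewrite !mul_row_col => v0.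
  have /sub_kermxP/submx_trans/(_ (ses_exact S))/submxP[w wE] : v2 *m p = 0.
    have := congr1 (mulmx^~ p') v0; rewrite mulmxDl -!mulmxA (ses_comp S') mulmx0 add0r.
    by rewrite hE mul0mx.
  (* The kernel of the surjection consists of the pairs (- w k, w i), on which [f] and [phi] cancel
     because i phi = k f. *)
  suff -> : v1 = - (w *m k) by rewrite wE -mulmxA phiE mulNmx mulmxA addNr.
  apply: (row_free_cancel (ses_mono S')).
  by rewrite mulNmx -mulmxA kE mulmxA -wE; apply/eqP; rewrite -addr_eq0 v0.
exists g => //.
by have := dinlE i' h; move/(congr1 (mulmx^~ g)); rewrite -mulmxA gE dinlE.
Qed.

Lemma ext0_proj P N : projective P -> ext0 P N.
Proof.
move=> pP K E i p S f hf.
have [s [hs sE]] := pP _ _ p 1%:M (ses_homr S) (ses_epi S) (@hom1 _ _ P).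
have [|r hr rE] := ses_factorl S (homB (@hom1 _ _ E) (homM (ses_homr S) hs)).
  by rewrite mulmxBl mul1mx -mulmxA sE mulmx1 subrr.
exists (r *m f); first exact: homM.
suff ir : i *m r = 1%:M by rewrite mulmxA ir mul1mx.
apply: (row_free_cancel (ses_mono S)); rewrite -mulmxA rE mulmxBr mulmx1 mulmxA.
by rewrite (ses_comp S) mul0mx subr0 mul1mx.
Qed.

Lemma ext0_inj I X : injective I -> ext0 X I.
Proof.
move=> iI K E i p S f hf.
by have [h [hh hE]] := iI _ _ i f (ses_homl S) (ses_mono S) hf; exists h.
Qed.

(** The piece Hom(X, Y) -> Hom(X, Z) -> Ext^1(X, V) of the long exact sequence: lift on a projective
    mapping onto [X], then correct by an extension [w] of the restriction to the kernel. *)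
Lemma ext0_lift X V Y Z (i : V ~> Y) (g : Y ~> Z) (f : X ~> Z) :
  ext0 X V -> ses i g -> ishom f -> exists2 h : X ~> Y, ishom h & h *m g = f.
Proof.
move=> xt S hf; have [P [p [pP hp rp]]] := enough_proj X.
have [K [k Sk]] := ker_ses hp rp.
have [h [hh hE]] := pP _ _ g (p *m f) (ses_homr S) (ses_epi S) (homM hp hf).
have [|u hu uE] := ses_factorl S (homM (ses_homl Sk) hh).
  by rewrite -mulmxA hE mulmxA (ses_comp Sk) mul0mx.
have [w hw wE] := xt _ _ _ _ Sk _ hu.
have [|r hr rE] := ses_factorr Sk (homB hh (homM hw (ses_homl S))).
  by rewrite mulmxBr mulmxA wE uE subrr.
exists r => //; apply: (row_full_cancel rp).
by rewrite mulmxA rE mulmxBl hE -mulmxA (ses_comp S) mulmx0 subr0.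
Qed.

(* The connecting map identifies Ext^1(X, N) with the cokernel of Hom(X, I) -> Hom(X, N'). *)
Lemma ext0_copres X N I N' (i : N ~> I) (p : I ~> N') : ses i p -> injective I ->
  (forall f : X ~> N', ishom f -> exists2 h : X ~> I, ishom h & h *m p = f) -> ext0 X N.
Proof.
move=> S iI lift K E k q Sk f hf.
have [g hg gE] := ext0_inj iI Sk (homM hf (ses_homl S)).
have [|u hu uE] := ses_factorr Sk (homM hg (ses_homr S)).
  by rewrite mulmxA gE -mulmxA (ses_comp S) mulmx0.
have [h hh hE] := lift _ hu.
have [|r hr rE] := ses_factorl S (homB hg (homM (ses_homr Sk) hh)).
  by rewrite mulmxBl -mulmxA hE uE subrr.
exists r => //; apply: (row_free_cancel (ses_mono S)).
by rewrite -mulmxA rE mulmxBr mulmxA (ses_comp Sk) mul0mx subr0 gE.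
Qed.

(** Direct summands of [X^m] occur in this form in [in_add]. An injective copresentation turns the
    claim into lifting maps out of [M], and the lifts obtained through each [r k] can be summed
    without forming [X^m]. *)
Lemma ext0_sum_retract X M N m (s : 'I_m -> (M ~> X)) (r : 'I_m -> (X ~> M)) :
  (forall k, ishom (s k)) -> (forall k, ishom (r k)) ->
  \sum_(k < m) (s k *m r k) = 1%:M -> ext0 X N -> ext0 M N.
Proof.
move=> hs hr sr xt; have [I [i [iI hi ri]]] := enough_inj N.
have [N' [p S]] := coker_ses hi ri.
apply: (ext0_copres S iI) => f hf.
have /fin_all_exists2[h hh hE] k : exists2 h : X ~> I, ishom h & h *m p = r k *m f.
  by apply: (ext0_lift xt S); apply: homM.
exists (\sum_(k < m) (s k *m h k)); first by apply: hom_sum => k; apply: homM.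
rewrite mulmx_suml -[f]mul1mx -sr mulmx_suml; apply: eq_bigr => k _.
by rewrite -mulmxA hE mulmxA.
Qed.

Lemma ext0_retract X M N (s : M ~> X) (r : X ~> M) :
  ishom s -> ishom r -> s *m r = 1%:M -> ext0 X N -> ext0 M N.
Proof.
move=> hs hr sr; apply: (@ext0_sum_retract _ _ _ 1 (fun=> s) (fun=> r)) => //.
by rewrite big_ord1.
Qed.

Lemma ext0_extl X E Y N (i : X ~> E) (p : E ~> Y) : ses i p ->
  ext0 X N -> ext0 Y N -> ext0 E N.
Proof.
move=> S xX xY K Q k q Sk f hf.
have [K2 [k2 [k' [q' [S2 S' k'E q'E]]]]] := ses_pull Sk S.
have [g1 hg1 g1E] := xX _ _ _ _ S' _ hf.
have [g hg gE] := xY _ _ _ _ S2 _ hg1.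
by exists g => //; rewrite -k'E -mulmxA gE.
Qed.

Lemma ext0_extr X N1 N N2 (i : N1 ~> N) (p : N ~> N2) : ses i p ->
  ext0 X N1 -> ext0 X N2 -> ext0 X N.
Proof.
move=> S x1 x2; have [P [q [pP hq rq]]] := enough_proj X.
have [K [k Sk]] := ker_ses hq rq.
apply: (ext0_pres Sk pP) => f hf.
have [g hg gE] := x2 _ _ _ _ Sk _ (homM hf (ses_homr S)).
have [h [hh hE]] := pP _ _ p g (ses_homr S) (ses_epi S) hg.
have [|u hu uE] := ses_factorl S (homB hf (homM (ses_homl Sk) hh)).
  by rewrite mulmxBl -mulmxA hE gE subrr.
have [w hw wE] := x1 _ _ _ _ Sk _ hu.
exists (h + w *m i); first by apply: homD hh (homM hw (ses_homl S)).
by rewrite mulmxDr mulmxA wE uE addrC subrK.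
Qed.

(** Exactness of Hom(R, Y) -> Ext^1(S, Y) -> Ext^1(D, Y); used with [R] the radical of a standard
    module [D]. *)
Lemma ext0_topquo R D S Y (i : R ~> D) (p : D ~> S) : ses i p -> ext0 D Y ->
  (forall f : R ~> Y, ishom f -> f = 0) -> ext0 S Y.
Proof.
move=> Sr xD h0; have [P [q [pP hq rq]]] := enough_proj D.
have [K [k Sk]] := ker_ses hq rq.
have [K2 [k2 [k' [q' [S2 S' k'E q'E]]]]] := ses_pull Sk Sr.
apply: (ext0_pres S2 pP) => f hf.
have [g hg gE] := xD _ _ _ _ Sk _ (homM (ses_homl S') hf).
exists g => //.
have [|u hu uE] := ses_factorr S' (homB hf (homM (ses_homl S2) hg)).
  by rewrite mulmxBr mulmxA k'E gE subrr.
by apply/eqP; rewrite eq_sym -subr_eq0 -uE (h0 _ hu) mulmx0.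
Qed.

(** Exactness of Hom(X, Q) -> Ext^1(X, V) -> Ext^1(X, N); used with [V] the socle of a proper
    costandard module [N]. *)
Lemma ext0_sub V N Q X (i : V ~> N) (p : N ~> Q) : ses i p -> ext0 X N ->
  (forall f : X ~> Q, ishom f -> f = 0) -> ext0 X V.
Proof.
move=> S xN h0 K E k q Sk f hf.
have [g hg gE] := xN _ _ _ _ Sk _ (homM hf (ses_homl S)).
have [|u hu uE] := ses_factorr Sk (homM hg (ses_homr S)).
  by rewrite mulmxA gE -mulmxA (ses_comp S) mulmx0.
have [|r hr rE] := ses_factorl S hg; first by rewrite -uE (h0 _ hu) mulmx0.
by exists r => //; apply: (row_free_cancel (ses_mono S)); rewrite -mulmxA rE.
Qed.

(* [ext0 K N] stands for Ext^2(X, N) = 0. *)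
Lemma ext0_quo K P X N Y Y' (k : K ~> P) (q : P ~> X) (i : N ~> Y) (p : Y ~> Y') :
  ses k q -> projective P -> ext0 K N -> ses i p -> ext0 X Y -> ext0 X Y'.
Proof.
move=> Sk pP xK S xX; apply: (ext0_pres Sk pP) => f hf.
have [h hh hE] := ext0_lift xK S hf.
have [g hg gE] := xX _ _ _ _ Sk _ hh.
exists (g *m p); first exact: homM hg (ses_homr S).
by rewrite mulmxA gE.
Qed.

Fixpoint cosyzygy n N : Prop := if n is n'.+1 then
  exists N0 I (i : N0 ~> I) (p : I ~> N), [/\ ses i p, injective I & cosyzygy n' N0] else True.

(* pd M <= n: by dimension shifting in the second argument, Ext^{n+1}(M, -) is Ext^1(M, -)
   on n-th cosyzygies. *)
Definition pd_le n M := forall N, cosyzygy n N -> ext0 M N.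

Lemma cosyzygyW n N : cosyzygy n.+1 N -> cosyzygy n N.
Proof.
elim: n N => [//|n IH] N [N0 [I [i [p [S iI /IH c]]]]].
by exists N0, I, i, p.
Qed.

Lemma pd_leW n m M : (n <= m)%N -> pd_le n M -> pd_le m M.
Proof.
move=> /subnK <-; elim: (m - n)%N => // k IH /IH pM N /cosyzygyW; exact: pM.
Qed.

Lemma pd_le_proj P n : projective P -> pd_le n P.
Proof. by move=> pP N _; apply: ext0_proj. Qed.

Lemma pd_le0 P : pd_le 0 P -> projective P.
Proof.
move=> pd M N g f hg rg hf; have [K [k S]] := ker_ses hg rg.
by have [h hh hE] := ext0_lift (pd K I) S hf; exists h.
Qed.

Lemma pd_le_ext n X E Y (i : X ~> E) (p : E ~> Y) : ses i p ->
  pd_le n X -> pd_le n Y -> pd_le n E.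
Proof. by move=> S pX pY N cN; apply: (ext0_extl S); [apply: pX|apply: pY]. Qed.

(** Exactness of Ext^1(E, N) -> Ext^1(X, N) -> Ext^2(Y, N), the last term being Ext^1(Y, N') by
    dimension shift. *)
Lemma ext0_ker X E Y (i : X ~> E) (p : E ~> Y) N I N' (a : N ~> I) (b : I ~> N') :
  ses i p -> ses a b -> injective I -> ext0 E N -> ext0 Y N' -> ext0 X N.
Proof.
move=> S Sa iI xE xY; apply: (ext0_copres Sa iI) => f hf.
have [g hg gE] := xY _ _ _ _ S _ hf.
have [h hh hE] := ext0_lift xE Sa hg.
by exists (i *m h); [exact: homM (ses_homl S) hh|rewrite -mulmxA hE].
Qed.

Lemma pd_le_ker n X E Y (i : X ~> E) (p : E ~> Y) : ses i p ->
  pd_le n E -> pd_le n.+1 Y -> pd_le n X.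
Proof.
move=> S pE pY N cN; have [I [a [iI ha ra]]] := enough_inj N.
have [N' [b Sa]] := coker_ses ha ra.
by apply: (ext0_ker S Sa iI); [exact: pE|apply: pY; exists N, I, a, b].
Qed.

(** Exactness of Ext^{n+1}(X, -) -> Ext^{n+2}(Y, -) -> Ext^{n+2}(E, -), chased on two consecutive
    cosyzygies. *)
Lemma pd_le_coker n X E Y (i : X ~> E) (p : E ~> Y) : ses i p ->
  pd_le n X -> pd_le n.+1 E -> pd_le n.+1 Y.
Proof.
move=> S pX pE N' cN'; have [N [I [a [b [Sa iI cN]]]]] := cN'.
have [I' [a' [iI' ha' ra']]] := enough_inj N'.
have [N'' [b' Sa']] := coker_ses ha' ra'.
apply: (ext0_copres Sa' iI') => f hf.
have [g hg gE] := ext0_lift (pE _ cN') Sa' (homM (ses_homr S) hf).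
have [|u hu uE] := ses_factorl Sa' (homM (ses_homl S) hg).
  by rewrite -mulmxA gE mulmxA (ses_comp S) mul0mx.
(* On [X] the map [g] comes from [u] into [N']. Lifting [u] to [I] and extending it over [E] gives
   the correction [w *m (b *m a')], which makes [g] vanish on [X] and is killed by [b']. *)
have [v hv vE] := ext0_lift (pX _ cN) Sa hu.
have [w hw wE] := ext0_inj iI S hv.
have hab := homM hw (homM (ses_homr Sa) (ses_homl Sa')).
have [|h hh hE] := ses_factorr S (homB hg hab).
  by rewrite mulmxBr (mulmxA i w) wE -uE -vE mulmxA subrr.
exists h => //; apply: (row_full_cancel (ses_epi S)).
by rewrite mulmxA hE mulmxBl gE -!mulmxA (ses_comp Sa') !mulmx0 subr0.
Qed.

Lemma has_resS (C : amod A -> Prop) N l : has_res C N l.+1 ->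
  exists K X (i : K ~> X) (p : X ~> N), [/\ ses i p, C X & has_res C K l].
Proof.
case=> X [f [f0 [CX [hf hf0] rf0 [e0 e1] [_ r1]]]].
have [K [k S]] := ker_ses hf0 rf0.
have /eqmxP ef := e0 isT.
have [|g hg gE] := ses_factorl S (hf 0); first by apply/sub_kermxP; rewrite ef.
exists K, (X 0%N), k, f0; split=> //; first exact: CX.
have ke : (k <= f 0%N)%MS by rewrite ef; apply/sub_kermxP; apply: ses_comp S.
exists (fun i => X i.+1), (fun i => f i.+1), g; split.
- by move=> i il; apply: CX.
- by split=> // i.
- have /submxP[d dE] := ke; apply/row_fullP; exists d.
  by apply: (row_free_cancel (ses_mono S)); rewrite -mulmxA gE mul1mx.
- split=> [l0|i il]; last exact: e1.
  have E : (kermx g :=: kermx (f 0%N))%MS.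
    apply/eqmxP/andP; split; apply/sub_kermxP; first by rewrite -gE mulmxA mulmx_ker mul0mx.
    by apply: (row_free_cancel (ses_mono S)); rewrite -mulmxA gE mulmx_ker mul0mx.
  by apply/eqmxP; apply: eqmx_trans (eqmx_sym E); apply/eqmxP; apply: e1.
split=> [l0|i li]; last by apply: r1; rewrite li.
have /row_freeP[c cE] : row_free (f 0%N) by apply: r1; rewrite l0.
by apply/row_freeP; exists (k *m c); rewrite mulmxA gE.
Qed.

Lemma has_res_cons (C : amod A -> Prop) K X N l (i : K ~> X) (p : X ~> N) :
  ses i p -> C X -> has_res C K l -> has_res C N l.+1.
Proof.
move=> S CX [Y [f [f0 [CY [hf hf0] rf0 [e0 e1] [r0 r1]]]]].
pose Z j := if j is j'.+1 then Y j' else X.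
pose g j : Z j.+1 ~> Z j := match j with 0%N => f0 *m i | j'.+1 => f j' end.
exists Z, g, p; split.
- by case=> [|j] jl //=; apply: CY.
- by split; [case=> [|j] //=; apply: homM hf0 (ses_homl S)|exact: ses_homr S].
- exact: ses_epi S.
- split=> [_|[|j] jl /=]; last exact: e1.
    rewrite /g /=; apply/andP; split.
      by apply/sub_kermxP; rewrite -mulmxA (ses_comp S) mulmx0.
    apply: submx_trans (ses_exact S) _.
    by have /row_fullP[d dE] := rf0; apply/submxP; exists d; rewrite mulmxA dE mul1mx.
  have E : (kermx f0 :=: kermx (f0 *m i))%MS.
    apply/eqmxP/andP; split; apply/sub_kermxP; first by rewrite mulmxA mulmx_ker mul0mx.
    by apply: (row_free_cancel (ses_mono S)); rewrite -mulmxA mulmx_ker mul0mx.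
  by apply/eqmxP; apply: eqmx_trans E; apply/eqmxP; apply: e0.
split=> // -[|j] [lj] /=; last exact: r1.
by apply: row_free_comp (ses_mono S); apply: r0.
Qed.

Lemma pd_le_res (C : amod A -> Prop) t N l : (forall X, C X -> pd_le t X) ->
  has_res C N l -> pd_le (l + t) N.
Proof.
move=> CP; elim: l N => [|l IH] N.
  case=> X [f [f0 [CX [_ hf0] rf0 _ [/(_ erefl) ff0 _]]]] N' cN'.
  have xX := CP _ (CX _ (leqnn _)) _ cN'.
  have [K [k S]] := ker_ses hf0 rf0.
  (* In length 0 the map [f0] is bijective; its linear inverse is automatically equivariant, so [N]
     is a retract of [X 0]. *)
  have /row_fullP[s sE] := rf0.
  apply: (@ext0_retract (X 0%N) N N' s f0) => //.
  move=> a; apply: (row_free_cancel ff0).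
  by rewrite -!mulmxA sE mulmx1 hf0 mulmxA sE mul1mx.
case/has_resS=> K [X [i [p [S CX /IH pK]]]].
rewrite addSn; apply: pd_le_coker S pK _.
by apply: pd_leW (CP _ CX); rewrite -addSn leq_addl.
Qed.

Lemma has_res_proj N p : pd_le p N -> has_res (@projective F A) N p.
Proof.
elim: p N => [|p IH] N pN.
  exists (fun=> N), (fun=> 0), 1%:M.
  have r1 : row_free (1%:M : 'M[F]_(mdim N)) /\ row_full (1%:M : 'M[F]_(mdim N)).
    by rewrite row_free_unit row_full_unit unitmx1.
  split=> //; [by move=> i _; apply: pd_le0|by split=> [i|]; [exact: hom0|exact: hom1]| |].
    by case: r1.
  by split=> // _; case: r1.
have [P [q [pP hq rq]]] := enough_proj N.
have [K [k S]] := ker_ses hq rq.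
apply: (has_res_cons S pP); apply: IH; apply: (pd_le_ker S) => //.
exact: pd_le_proj.
Qed.

End Ext.

(** * Filtrations and composition factors *)

Section Filtrations.
Variables (F : fieldType) (A : falgType F).
Implicit Types (M N X Y Z K P E S Q I : amod A) (C : amod A -> Prop).
Local Notation "M ~> N" := 'M[F]_(mdim M, mdim N) : type_scope.

(** The chains of subspaces in [inF] are replaced by an induction that splits off the top layer. Its
    base is any module of dimension 0, there being no preferred zero module. *)
Inductive Fil C : amod A -> Prop :=
| Fil0 M : mdim M = 0%N -> Fil C M
| FilS X E Y (i : X ~> E) (p : E ~> Y) : ses i p -> Fil C X -> C Y -> Fil C E.

Lemma Fil_mono C C' M : (forall X, C X -> C' X) -> Fil C M -> Fil C' M.
Proof.
move=> CC'; elim=> [Z|X E Y i p S _ FX /CC' CY]; first exact: Fil0.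
exact: FilS S FX CY.
Qed.

Lemma Fil_iso C X Y (f : X ~> Y) : ishom f -> row_free f -> row_full f -> Fil C X -> Fil C Y.
Proof.
move=> hf ff rf FX; case: FX f hf ff rf => [Z Z0|X' X0 D i p S FX' CD] f hf ff rf.
  by apply: Fil0; rewrite -(eqP rf) (eqP ff).
have [|g hg gE] := hom_factor_mono hf ff (@hom1 _ _ Y); first by apply: submx_full.
have fg : f *m g = 1%:M by apply: (row_free_cancel ff); rewrite -mulmxA gE mulmx1 mul1mx.
apply: (@FilS C X' Y D (i *m f) (g *m p)) => //; split.
- exact: homM (ses_homl S) hf.
- exact: homM hg (ses_homr S).
- exact: row_free_comp (ses_mono S) ff.
- apply: row_full_comp (ses_epi S); by apply/row_fullP; exists f.
- by rewrite mulmxA -(mulmxA i) fg mulmx1 (ses_comp S).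
have /sub_kermxP/submx_trans/(_ (ses_exact S))/submxP[d dE] : kermx (g *m p) *m g *m p = 0.
  by rewrite -mulmxA mulmx_ker.
by apply/submxP; exists d; rewrite mulmxA -dE -mulmxA gE mulmx1.
Qed.

(** Induction on the filtration of [Y]: the preimage in [E] of the lower part of [Y] is an extension
    of that part by [X], and the top layer stays on top. *)
Lemma Fil_ext C X E Y (i : X ~> E) (p : E ~> Y) :
  ses i p -> Fil C X -> Fil C Y -> Fil C E.
Proof.
move=> S FX FY; elim: FY E i p S => [Z Z0|Y' Y0 D a b Sa _ IH CD] E i p S.
  apply: Fil_iso (ses_homl S) (ses_mono S) _ FX.
  apply/eqP; apply: etrans (eqP (ses_mono S)) _.
  by rewrite (ses_dim S) Z0 addn0.
have [K2 [k2 [k' [q' [S2 S' _ _]]]]] := ses_pull S Sa.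
exact: FilS S2 (IH _ _ _ S') CD.
Qed.

Lemma subquot_ses M (U V : 'M[F]_(mdim M)) D X (i : X ~> M) :
  subquot U V D -> ishom i -> row_free i -> (i :=: V)%MS ->
  exists K (k : K ~> X) (p : X ~> D), ses k p /\ (k *m i :=: U)%MS.
Proof.
case=> UV [h [hV rV /eqmxP kV]] hi ri iV.
have /submxP[d dE] : (i <= V)%MS by rewrite iV.
have /submxP[e eE] : (V <= i)%MS by rewrite iV.
have hp : @ishom F A X D (i *m h).
  by move=> a; rewrite mulmxA hi dE -!mulmxA; congr (_ *m _); rewrite hV mulmxA.
have rp : row_full (i *m h).
  by have /row_fullP[c cE] := rV; apply/row_fullP; exists (c *m e); rewrite -mulmxA [e *m _]mulmxA -eE.
have [K [k S]] := ker_ses hp rp.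
exists K, k, (i *m h); split=> //; apply/eqmxP/andP; split.
  rewrite -kV sub_capmx -iV submxMl /=; apply/sub_kermxP.
  by rewrite -mulmxA (ses_comp S).
have /submxP[c cE] : (U <= i)%MS by rewrite iV.
rewrite cE submxMr //; apply: submx_trans (ses_exact S); apply/sub_kermxP.
by rewrite mulmxA -cE; apply/sub_kermxP; rewrite -kV capmxSr.
Qed.

(** The witness is composed with a linear left inverse of the inclusion. That inverse is no module
    map, but [subquot] asks for equivariance on [V] only. *)
Lemma subquot_push X M (i : X ~> M) (U V : 'M[F]_(mdim X)) (U' V' : 'M[F]_(mdim M)) D :
  ishom i -> row_free i -> (U' :=: U *m i)%MS -> (V' :=: V *m i)%MS ->
  subquot U V D -> subquot U' V' D.
Proof.
move=> hi ri eU eV [UV [h [hV rV /eqmxP kV]]].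
split; first by rewrite eU eV submxMr.
have /row_freeP[c cE] := ri.
have ch : i *m (c *m h) = h by rewrite mulmxA cE mul1mx.
exists (c *m h); split.
- move=> a; have /submxP[d ->] : (V' <= V *m i)%MS by rewrite eV.
  have -> : d *m (V *m i) *m (mact M a *m (c *m h)) = d *m (V *m (mact X a *m (i *m (c *m h)))).
    by rewrite -!mulmxA (mulmxA i (mact M a)) -hi -!mulmxA.
  by rewrite ch hV -!mulmxA (mulmxA c h) (mulmxA i (c *m h)) ch.
- by rewrite /row_full (eqmxMr _ eV) -mulmxA ch.
apply/andP; split.
  apply/rV_subP => v; rewrite sub_capmx eV => /andP[/submxP[w ->] /sub_kermxP v0].
  rewrite eU mulmxA submxMr // -kV sub_capmx submxMl /=; apply/sub_kermxP.
  by rewrite -[h]ch mulmxA -[w *m V *m i]mulmxA.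
rewrite sub_capmx !eU eV submxMr //=; apply/sub_kermxP; rewrite -mulmxA ch.
by apply/sub_kermxP; rewrite -kV capmxSr.
Qed.

Lemma subquot_top X E Y (i : X ~> E) (p : E ~> Y) (U V : 'M[F]_(mdim E)) :
  ses i p -> (U :=: i)%MS -> row_full V -> subquot U V Y.
Proof.
move=> S eU rV; split; first by apply: submx_full.
exists p; split.
- by move=> a; rewrite (ses_homr S) mulmxA.
- exact: row_full_comp rV (ses_epi S).
apply/andP; split; first by rewrite eU (submx_trans (capmxSr _ _)) // (ses_exact S).
by rewrite sub_capmx submx_full //=; rewrite eU; apply/sub_kermxP; apply: ses_comp S.
Qed.

(** The induction runs over all modules embedded in [M] with image [s k], since a submodule given as
    a matrix is not itself an [amod]. *)
Lemma inF_Fil C M : inF C M -> Fil C M.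
Proof.
case=> l [s [[/eqmxP s0 /eqmxP sl _] st]].
suff H k : (k <= l)%N -> forall X (i : X ~> M), ishom i -> row_free i -> (i :=: s k)%MS -> Fil C X.
  apply: (H l (leqnn l) M 1%:M) => //; [exact: hom1|by rewrite row_free_unit unitmx1|].
  exact: eqmx_sym.
elim: k => [|k IH] kl X i hi ri ie.
  by apply: Fil0; move/eqP: ri => <-; rewrite ie s0 mxrank0.
have [D [CD /subquot_ses sq]] := st _ kl.
have [K [k' [p [S kE]]]] := sq _ _ hi ri ie.
apply: (FilS S _ CD); apply: (IH (ltnW kl) K (k' *m i)) => //.
- exact: homM (ses_homl S) hi.
- exact: row_free_comp (ses_mono S) ri.
Qed.

Lemma Fil_inF C M : Fil C M -> inF C M.
Proof.
elim=> [Z Z0|X E Y i p S _ [l [s [[/eqmxP s0 /eqmxP sl sub] st]]] CY].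
  exists 0%N, (fun=> 0); split=> //; split; [exact/eqmxP| |by move=> i _; apply: submod0].
  by apply/andP; split; [exact: sub0mx|move: (1%:M : 'M[F]_(mdim Z)); rewrite Z0 => x; rewrite [x]flatmx0 sub0mx].
pose s' j := if (j <= l)%N then <<s j *m i>>%MS else 1%:M.
exists l.+1, s'; split; first split.
- have z : s 0%N = 0 by apply/eqP; rewrite -submx0 s0.
  by rewrite /s' /= z mul0mx genmxE !sub0mx.
- by rewrite /s' ltnn; apply/eqmxP.
- move=> j _; rewrite /s'; case: ifP => [/sub|_]; first exact: submod_im (ses_homl S).
  by move=> a; apply: submx1.
move=> j; rewrite ltnS leq_eqVlt => /orP[/eqP->|jl].
  exists Y; split=> //; rewrite /s' leqnn ltnn; apply: (subquot_top S).
    apply: eqmx_trans (genmxE _) _; apply: eqmx_trans (eqmxMr _ sl) _.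
    by rewrite mul1mx.
  by rewrite row_full_unit unitmx1.
have [D [CD sq]] := st _ jl; exists D; split=> //.
rewrite /s' jl (ltnW jl).
by apply: subquot_push sq; [exact: ses_homl S|exact: ses_mono S|exact: genmxE|exact: genmxE].
Qed.

Lemma simple_epi M S (f : M ~> S) : simple S -> ishom f -> f <> 0 -> row_full f.
Proof.
move=> [_ sS] hf f0; have [r0|/eqmxP e1] := sS _ (hom_im hf).
  by case: f0; apply/eqP; rewrite -mxrank_eq0 -genmxE r0.
by rewrite -sub1mx -e1 genmxE.
Qed.

Lemma simple_mono S M (f : S ~> M) : simple S -> ishom f -> f <> 0 -> row_free f.
Proof.
move=> [_ sS] hf f0; have [r0|/eqmxP e1] := sS _ (hom_ker hf).
  by rewrite -kermx_eq0 -mxrank_eq0 r0.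
by case: f0; rewrite -[f]mul1mx; apply/sub_kermxP; rewrite e1.
Qed.

Lemma hom_nonzero_simple M S (f : M ~> S) : simple S -> row_full f -> f <> 0.
Proof. by case=> S0 _ /eqP rf f0; move: S0; rewrite -rf f0 mxrank0. Qed.

Lemma hom_nonzero_simplel S M (f : S ~> M) : simple S -> row_free f -> f <> 0.
Proof. by case=> S0 _ /eqP rf f0; move: S0; rewrite -rf f0 mxrank0. Qed.

Lemma simple_subobj M : (0 < mdim M)%N ->
  exists S (j : S ~> M), [/\ simple S, ishom j & row_free j].
Proof.
have [m] := ubnP (mdim M); elim: m M => // m IH M Mm M0.
case: (classic (simple M)) => [sM|nS].
  by exists M, 1%:M; split; [|exact: hom1|rewrite row_free_unit unitmx1].
case: (classic (exists U : 'M_(mdim M), [/\ submod U, \rank U <> 0%N & ~ (U == 1%:M)%MS])); last first.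
  move=> nex; case: nS; split=> // U sU; apply: NNPP => nor.
  by apply: nex; exists U; split=> // h; apply: nor; [left|right].
case=> U [sU rU nU]; have [X [i [hi ri iU]]] := subobj sU.
have dX : mdim X = \rank U by rewrite -(eqP ri) iU.
have [||S [j [sS hj rj]]] := IH X.
- rewrite dX -ltnS (leq_trans _ Mm) // ltnS ltn_neqAle rank_leq_row andbT.
  by apply/negP => rU1; apply: nU; rewrite submx1 sub1mx.
- by rewrite dX lt0n; apply/eqP.
by exists S, (j *m i); split=> //; [exact: homM|exact: row_free_comp].
Qed.

Lemma simple_quoobj M : (0 < mdim M)%N ->
  exists S (q : M ~> S), [/\ simple S, ishom q & row_full q].
Proof.
have [m] := ubnP (mdim M); elim: m M => // m IH M Mm M0.
case: (classic (simple M)) => [sM|nS].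
  by exists M, 1%:M; split; [|exact: hom1|rewrite row_full_unit unitmx1].
case: (classic (exists U : 'M_(mdim M), [/\ submod U, \rank U <> 0%N & ~ (U == 1%:M)%MS])); last first.
  move=> nex; case: nS; split=> // U sU; apply: NNPP => nor.
  by apply: nex; exists U; split=> // h; apply: nor; [left|right].
case=> U [sU rU nU]; have [X [i [hi ri iU]]] := quoobj sU.
have dX : mdim X = (mdim M - \rank U)%N by rewrite -(eqP ri) -iU mxrank_ker subKn // rank_leq_row.
have [||S [j [sS hj rj]]] := IH X.
- rewrite dX -ltnS (leq_trans _ Mm) // ltnS ltn_subrL M0 andbT lt0n.
  exact/eqP.
- rewrite dX subn_gt0 ltn_neqAle rank_leq_row andbT.
  by apply/negP => rU1; apply: nU; rewrite submx1 sub1mx.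
by exists S, (i *m j); split=> //; [exact: homM|exact: row_full_comp].
Qed.

Lemma proj_cover_superfluous P (L : amod A) X (p : P ~> L) (w : X ~> P) :
  (forall W : 'M[F]_(mdim P), submod W -> (W + kermx p == 1%:M)%MS -> (W == 1%:M)%MS) ->
  ishom w -> row_full (w *m p) -> row_full w.
Proof.
move=> sup hw rwp; have /eqmxP e1 : (<<w>> == (1%:M : 'M[F]_(mdim P)))%MS.
  apply: sup; first exact: hom_im.
  rewrite submx1; apply/rV_subP => v _.
  have /submxP[u uE] : (v *m p <= w *m p)%MS by apply: submx_full.
  rewrite -[v](subrK (u *m w)) addrC; apply: addmx_sub_adds; first by rewrite genmxE submxMl.
  by apply/sub_kermxP; rewrite mulmxBl uE mulmxA subrr.
by rewrite -sub1mx -e1 genmxE.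
Qed.

Lemma ext0_zerol X N : mdim X = 0%N -> ext0 X N.
Proof.
move=> X0; apply: ext0_proj => M Y g f _ _ _; exists 0; split; first exact: hom0.
by apply/matrixP => i; exfalso; move: (i); rewrite X0 => -[].
Qed.

Lemma ext0_zeror X N : mdim N = 0%N -> ext0 X N.
Proof.
move=> N0 K E i p S f hf; exists 0; first exact: hom0.
by apply/matrixP => a b; exfalso; move: (b); rewrite N0 => -[].
Qed.

Lemma ext0_Fill C X N : (forall D, C D -> ext0 D N) -> Fil C X -> ext0 X N.
Proof.
move=> H; elim=> [Z|X' E Y i p S _ xX /H xY]; first exact: ext0_zerol.
exact: ext0_extl S xX xY.
Qed.

Lemma ext0_Filr C X N : (forall D, C D -> ext0 X D) -> Fil C N -> ext0 X N.
Proof.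
move=> H; elim=> [Z|X' E Y i p S _ xX /H xY]; first exact: ext0_zeror.
exact: ext0_extr S xX xY.
Qed.

End Filtrations.

(** * Composition factors and presentations of standard modules *)

Section Composition.
Variables (F : fieldType) (A : falgType F) (n : nat) (L : 'I_n -> amod A).
Hypothesis labL : simple_labeling L.
Implicit Types (M N X Y Z K P E S Q I : amod A) (p : pred 'I_n).
Local Notation "M ~> N" := 'M[F]_(mdim M, mdim N) : type_scope.

Lemma simpleL mu : simple (L mu). Proof. by case: labL. Qed.

(* All composition factors of [M] are [L mu] with [p mu], tested on the projective covers. *)
Definition facs p M := forall mu, ~~ p mu -> forall Q (f : Q ~> M),
  proj_cover Q (L mu) -> ishom f -> f = 0.

Lemma cover_hom_simple Q mu nu (f : Q ~> L nu) :
  proj_cover Q (L mu) -> ishom f -> f <> 0 -> mu = nu.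
Proof.
move=> [pQ [p [hp rp sup]]] hf f0.
have rf := simple_epi (simpleL nu) hf f0.
have sW := hom_ker hf; have [_ sL] := simpleL mu.
have [r0|/eqmxP e1] := sL _ (submod_im hp sW).
  have [|g hg gE] := hom_factor_epi hf rf hp.
    by apply/sub_kermxP/eqP; rewrite -mxrank_eq0 -genmxE r0.
  have g0 : g <> 0.
    by move=> g0; apply: (hom_nonzero_simple (simpleL mu) rp); rewrite -gE g0 mulmx0.
  have [_ inj _] := labL; apply/esym/inj; exists g; split=> //.
    by apply: simple_mono => //; apply: simpleL.
  by apply: simple_epi => //; apply: simpleL.
case: f0; rewrite -[f]mul1mx; apply/sub_kermxP.
have /eqmxP <- : (kermx f == (1%:M : 'M[F]_(mdim Q)))%MS; last by [].
apply: sup => //; rewrite submx1; apply/rV_subP => v _.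
have /submxP[u uE] : (v *m p <= kermx f *m p)%MS.
  by apply: submx_trans (submx1 _) _; rewrite -e1 genmxE.
rewrite -[v](subrK (u *m kermx f)) addrC; apply: addmx_sub_adds; first exact: submxMl.
by apply/sub_kermxP; rewrite mulmxBl uE mulmxA subrr.
Qed.

Lemma facs_simple p mu : p mu -> facs p (L mu).
Proof.
move=> pm nu pn Q f cQ hf; apply: NNPP => f0; move: pn.
by rewrite (cover_hom_simple cQ hf f0) pm.
Qed.

Lemma facsW p p' M : (forall mu, p mu -> p' mu) -> facs p M -> facs p' M.
Proof. by move=> pp' fM mu pm; apply: fM; apply: contra pm; apply: pp'. Qed.

Lemma facs_sub p X M (i : X ~> M) : ishom i -> row_free i -> facs p M -> facs p X.
Proof.
move=> hi ri fM mu pm Q f cQ hf; apply: (row_free_cancel ri); rewrite mul0mx.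
by apply: (fM mu) => //; apply: homM.
Qed.

Lemma facs_quo p M Y (q : M ~> Y) : ishom q -> row_full q -> facs p M -> facs p Y.
Proof.
move=> hq rq fM mu pm Q f cQ hf.
have [h [hh <-]] := cQ.1 _ _ q f hq rq hf.
by rewrite (fM mu pm Q h) // mul0mx.
Qed.

Lemma facs_ext p X E Y (i : X ~> E) (q : E ~> Y) : ses i q ->
  facs p X -> facs p Y -> facs p E.
Proof.
move=> S fX fY mu pm Q f cQ hf.
have [|g hg <-] := ses_factorl S hf.
  by apply: (fY mu) => //; apply: homM hf (ses_homr S).
by rewrite (fX mu pm Q g) // mul0mx.
Qed.

Lemma sub_label M : (0 < mdim M)%N -> exists mu (j : L mu ~> M), ishom j /\ row_free j.
Proof.
case/simple_subobj=> S [j [sS hj rj]]; have [_ _ /(_ S sS)[mu [f [hf ff rf]]]] := labL.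
have [|g hg gE] := hom_factor_mono hf ff (@hom1 _ _ (L mu)); first by apply: submx_full.
exists mu, (g *m j); split; first exact: homM.
by apply: row_free_comp rj; apply/row_freeP; exists f.
Qed.

Lemma quo_label M : (0 < mdim M)%N -> exists mu (q : M ~> L mu), ishom q /\ row_full q.
Proof.
case/simple_quoobj=> S [j [sS hj rj]]; have [_ _ /(_ S sS)[mu [f [hf ff rf]]]] := labL.
by exists mu, (j *m f); split; [exact: homM|exact: row_full_comp].
Qed.

Lemma hom_nonzero_dim M N (f : M ~> N) : f <> 0 -> (0 < mdim M)%N /\ (0 < mdim N)%N.
Proof.
move=> /eqP; rewrite -mxrank_eq0 -lt0n => r0.
by rewrite (leq_trans r0 (rank_leq_row f)) (leq_trans r0 (rank_leq_col f)).
Qed.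

Lemma hom_to_simple X N (f : X ~> N) : ishom f -> f <> 0 ->
  exists I (q : X ~> I) (i : I ~> N) mu (g : I ~> L mu),
    [/\ ishom q, ishom i, row_full q, row_free i & ishom g /\ row_full g].
Proof.
move=> hf f0; have [I [q [i [hq hi rq ri fE]]]] := im_factor hf.
have q0 : q <> 0 by move=> q0; apply: f0; rewrite fE q0 mul0mx.
have [_ /quo_label[mu [g [hg rg]]]] := hom_nonzero_dim q0.
by exists I, q, i, mu, g.
Qed.

Section Covers.
Hypothesis covL : forall mu, exists Q, proj_cover Q (L mu).

Lemma facs_top p M mu (q : M ~> L mu) : facs p M -> ishom q -> q <> 0 -> p mu.
Proof.
move=> fM hq q0; have [Q cQ] := covL mu; apply/negP => /negP pm.
have [pQ [c [hc rc _]]] := cQ.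
have [h [hh hE]] := pQ _ _ q c hq (simple_epi (simpleL mu) hq q0) hc.
apply: (hom_nonzero_simple (simpleL mu) rc).
by rewrite -hE (fM mu pm Q h) // mul0mx.
Qed.

Lemma facs_socle p M mu (j : L mu ~> M) : facs p M -> ishom j -> j <> 0 -> p mu.
Proof.
move=> fM hj j0; have rj := simple_mono (simpleL mu) hj j0.
apply: (@facs_top p (L mu) mu 1%:M (facs_sub hj rj fM) (@hom1 _ _ _)).
by apply: (hom_nonzero_simple (simpleL mu)); rewrite row_full_unit unitmx1.
Qed.

Lemma facs_Fil p M : facs p M -> Fil (fun X => exists2 mu, p mu & X = L mu) M.
Proof.
have [m] := ubnP (mdim M); elim: m M => // m IH M Mm fM.
case: (posnP (mdim M)) => [M0|/quo_label[mu [q [hq rq]]]]; first exact: Fil0.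
have [K [k S]] := ker_ses hq rq.
apply: (FilS S); last first.
  by exists mu => //; apply: facs_top fM hq (hom_nonzero_simple (simpleL mu) rq).
apply: IH; last exact: facs_sub (ses_homl S) (ses_mono S) fM.
move: Mm; rewrite (ses_dim S) ltnS => /(leq_trans _) -> //.
by rewrite -[X in (X < _)%N]addn0 ltn_add2l; case: (simpleL mu).
Qed.

Lemma facs_ext0l p Q Y : (forall mu, p mu -> ext0 (L mu) Y) -> facs p Q -> ext0 Q Y.
Proof. by move=> H /facs_Fil; apply: ext0_Fill => _ [mu /H xm ->]. Qed.

Lemma facs_ext0r p Q Y : (forall mu, p mu -> ext0 Y (L mu)) -> facs p Q -> ext0 Y Q.
Proof. by move=> H /facs_Fil; apply: ext0_Filr => _ [mu /H xm ->]. Qed.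

End Covers.

Record std_pres lam D P K (k : K ~> P) (q : P ~> D) (t : D ~> L lam) : Prop := StdPres {
  std_ses : ses k q; std_cover : proj_cover P (L lam); std_facs : facs (fun mu => mu <= lam)%N D;
  std_tors : forall N, facs (fun mu => mu <= lam)%N N -> forall f : K ~> N, ishom f -> f = 0;
  std_homt : ishom t; std_fullt : row_full t;
  std_top : forall X (w : X ~> D), ishom w -> row_full (w *m t) -> row_full w }.

Lemma std_presP lam D : is_std L lam D ->
  exists P K (k : K ~> P) (q : P ~> D) (t : D ~> L lam), std_pres k q t.
Proof.
case=> P [cP [U [q [[tU minU] hq rq /eqmxP kU]]]].
have [K [k S]] := ker_ses hq rq; have [pP [c [hc rc sup]]] := cP.
have kE : (k :=: U)%MS.
  by apply: eqmx_trans kU; apply/eqmxP/andP; split; [apply/sub_kermxP; exact: ses_comp S|exact: ses_exact S].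
have tors N : facs (fun mu => mu <= lam)%N N -> forall f : K ~> N, ishom f -> f = 0.
  move=> fN f hf; rewrite -[f]mul1mx; apply/sub_kermxP.
  (* The kernel of [f], embedded in [P], contains the image of every map from P(mu), mu > lam,
     because [N] has no factor L(mu). Minimality of the trace makes it all of [K]. *)
  suff /submxP[d dE] : (k <= kermx f *m k)%MS.
    have <- : d *m kermx f = 1%:M by apply: (row_free_cancel (ses_mono S)); rewrite -mulmxA -dE mul1mx.
    exact: submxMl.
  rewrite kE -(genmxE (kermx f *m k)); apply: minU => mu lmu Q g cQ hg; rewrite genmxE.
  have [|u hu uE] := ses_factorl S hg.
    by apply/sub_kermxP; rewrite kU; apply: tU lmu _ _ cQ hg.
  rewrite -uE submxMr //; apply/sub_kermxP.
  by apply: (fN mu) cQ (homM hu hf); rewrite -ltnNge.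
have fD : facs (fun mu => mu <= lam)%N D.
  move=> mu; rewrite -ltnNge => lmu Q f cQ hf.
  have [h [hh <-]] := cQ.1 _ _ q f hq rq hf.
  by apply/sub_kermxP; rewrite kU; apply: tU lmu _ _ cQ hh.
have [|t ht tE] := ses_factorr S hc.
  by apply: tors (homM (ses_homl S) hc); apply: facs_simple.
exists P, K, k, q, t; split=> //.
  by have /row_fullP[d dE] := rc; apply/row_fullP; exists (d *m q); rewrite -mulmxA tE.
move=> X w hw rw; have [Q [p [pQ hp rp]]] := enough_proj X.
have [h [hh hE]] := pQ _ _ q (p *m w) hq rq (homM hp hw).
have /row_fullP[d dE] : row_full h.
  apply: proj_cover_superfluous sup hh _.
  by rewrite -tE mulmxA hE -mulmxA; apply: row_full_comp.
have /row_fullP[e eE] := rq.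
by apply/row_fullP; exists (e *m d *m p); rewrite -!mulmxA -hE (mulmxA d) dE mul1mx.
Qed.

End Composition.

(** * Injective envelopes and proper costandard modules *)

Section InjectiveEnvelope.
Variables (F : fieldType) (A : falgType F).
Implicit Types (M N X Y Z K P E S Q I : amod A).
Local Notation "M ~> N" := 'M[F]_(mdim M, mdim N) : type_scope.

Lemma rank_rV0 m n (U : 'M[F]_(m, n)) : (forall v : 'rV_n, (v <= U)%MS -> v = 0) -> \rank U = 0%N.
Proof.
move=> H; apply/eqP; rewrite mxrank_eq0; apply/eqP/row_matrixP => i.
by rewrite row0; apply: H; apply: row_sub.
Qed.

Lemma rank0_rV m n (U : 'M[F]_(m, n)) (v : 'rV_n) : \rank U = 0%N -> (v <= U)%MS -> v = 0.
Proof. by move=> /eqP; rewrite mxrank_eq0 => /eqP U0 /submxP[d ->]; rewrite U0 mulmx0. Qed.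

Lemma injective_retract E I (i : I ~> E) (r : E ~> I) :
  ishom i -> ishom r -> i *m r = 1%:M -> injective E -> injective I.
Proof.
move=> hi hr ir iE X Y g f hg rg hf.
have [h [hh hE]] := iE _ _ g (f *m i) hg rg (homM hf hi).
exists (h *m r); split; first exact: homM.
by rewrite mulmxA hE -mulmxA ir mulmx1.
Qed.

(** [U] is a maximal essential extension of [j] inside an injective [E], and [W] a maximal submodule
    meeting [U] trivially. As [U] embeds in E/W, its inclusion extends to a map [h] on E/W. The
    image of [h] is again essential over [j], so it equals [U] by maximality, and [U] is a retract
    of [E]. *)
Lemma inj_env_exists S : exists I, inj_env S I.
Proof.
have [E [j [iE hj rj]]] := enough_inj S.
pose ess U := [/\ submod (M := E) U, (j <= U)%MS &
  forall W, submod (M := E) W -> (W <= U)%MS -> \rank W <> 0%N -> \rank (W :&: j)%MS <> 0%N].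
have [U [sU jU eU] maxU] : exists2 U, ess U & forall W, ess W -> (\rank W <= \rank U)%N.
  apply: ex_maxrank; exists <<j>>%MS; split; [exact: hom_im|by rewrite genmxE|].
  by move=> W _; rewrite genmxE => /capmx_idPl->.
have [I [i [hi ri iU]]] := subobj sU.
have [W [sW WU] maxW] : exists2 W : 'M_(mdim E), submod W /\ \rank (W :&: U)%MS = 0%N &
    forall W', submod W' /\ \rank (W' :&: U)%MS = 0%N -> (\rank W' <= \rank W)%N.
  by apply: ex_maxrank; exists 0; split; [exact: submod0|rewrite cap0mx mxrank0].
have [Q [q [hq rq qW]]] := quoobj sW.
have riq : row_free (i *m q).
  apply: mono_kerP => v; rewrite mulmxA => /sub_kermxP; rewrite qW => vW.
  apply: (row_free_cancel ri); rewrite mul0mx.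
  by apply: rank0_rV WU _; rewrite sub_capmx vW -iU submxMl.
have [h [hh hE]] := iE _ _ (i *m q) i (homM hi hq) riq hi.
have qhW W' : submod W' -> (W <= W')%MS -> ~ (W' <= W)%MS -> \rank (W' :&: U)%MS <> 0%N.
  move=> sW' WW' nW' r0; apply: nW'; have /leqifP := mxrank_leqif_sup WW'.
  by case: ifP => // _; rewrite ltnNge maxW.
have eh : ess <<h>>%MS.
  split; [exact: hom_im| |].
    by rewrite genmxE; apply: submx_trans jU _; rewrite -iU -hE submxMl.
  move=> W2 sW2; rewrite genmxE => W2h r2.
  have [Q2 [q2 [hq2 rq2 q2W]]] := quoobj sW2.
  (* If [W2] missed [U], so would its preimage under [q *m h], since this map is the identity on
     [U]. By maximality of [W] the preimage would lie in [W], forcing [W2] to vanish. *)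
  have r3 : \rank (W2 :&: U)%MS <> 0%N.
    move=> r0; have sW3 := hom_ker (homM (homM hq hh) hq2).
    have := qhW _ sW3; case.
    - apply/sub_kermxP; rewrite -mulmxA mulmxA (_ : W *m q = 0) ?mul0mx //.
      by apply/sub_kermxP; rewrite qW.
    - move=> W3W; apply: r2; apply: rank_rV0 => v vW2.
      have /submxP[w wE] := submx_trans vW2 W2h.
      have /row_fullP[d dE] := rq.
      have : (w *m d <= W)%MS.
        apply: submx_trans W3W; apply/sub_kermxP.
        rewrite !mulmxA -(mulmxA w) dE mulmx1 -wE; apply/sub_kermxP.
        by rewrite q2W.
      rewrite -qW => /sub_kermxP; rewrite -mulmxA dE mulmx1 => w0.
      by rewrite wE w0 mul0mx.
    apply: rank_rV0 => v; rewrite sub_capmx => /andP[/sub_kermxP v0 vU].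
    move: (vU); rewrite -iU => /submxP[w wE].
    have vE : v *m (q *m h) = v by rewrite wE -mulmxA (mulmxA i) hE.
    apply: (rank0_rV r0); rewrite sub_capmx vU andbT -q2W; apply/sub_kermxP.
    by rewrite -vE -mulmxA v0.
  have : \rank (W2 :&: U :&: j)%MS <> 0%N.
    by apply: eU => //; [exact: submod_cap|exact: capmxSr].
  move=> r4 r5; apply: r4; apply/eqP; rewrite -leqn0 -r5 mxrankS //.
  by rewrite capmxS ?capmxSl.
have hU : (h <= i)%MS.
  have Uh : (U <= <<h>>)%MS by rewrite genmxE -iU -hE submxMl.
  have /leqifP := mxrank_leqif_sup Uh; case: ifP => [|_].
    by rewrite genmxE => hU; rewrite iU.
  by rewrite ltnNge maxU.
have [g hg gE] := hom_factor_mono hi ri hh hU.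
have iI : injective I.
  apply: (injective_retract hi (homM hq hg) _ iE).
  by apply: (row_free_cancel ri); rewrite -!mulmxA gE mulmxA hE mul1mx.
have [|jI hjI jIE] := hom_factor_mono hi ri hj; first by rewrite iU.
exists I; split=> //; exists jI; split=> //.
  apply/row_freeP; have /row_freeP[c cE] := rj; exists (i *m c).
  by rewrite mulmxA jIE.
move=> W1 sW1 r1 r0; apply: (eU _ (submod_im hi sW1)).
- by rewrite genmxE -iU submxMl.
- by rewrite genmxE mxrankMfree.
apply: rank_rV0 => v; rewrite sub_capmx genmxE -{1}jIE => /andP[/submxP[w wE] /submxP[u uE]].
rewrite wE mulmxA; suff -> : w *m W1 = 0 by rewrite mul0mx.
apply: rank0_rV r0 _; rewrite sub_capmx submxMl /=.
suff -> : w *m W1 = u *m jI by rewrite submxMl.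
by apply: (row_free_cancel ri); rewrite -!mulmxA -wE uE.
Qed.

Lemma proj_sum_lift Q X Y M (a : X ~> M) (b : Y ~> M) (f : Q ~> M) : projective Q ->
  ishom a -> ishom b -> ishom f -> (f <= a + b)%MS ->
  exists (f1 : Q ~> X) (f2 : Q ~> Y), [/\ ishom f1, ishom f2 & f = f1 *m a + f2 *m b].
Proof.
move=> pQ ha hb hf; have [I [q [i [hq hi rq ri cE]]]] := im_factor (hom_col ha hb).
rewrite addsmxE cE => fqi.
have [|f' hf' f'E] := hom_factor_mono hi ri hf; first by rewrite (submx_trans fqi) ?submxMl.
have [h [hh hE]] := pQ _ _ q f' hq rq hf'.
exists (h *m @dprl F A X Y), (h *m @dprr F A X Y); split.
- exact: homM hh (@hom_dprl _ _ _ _).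
- exact: homM hh (@hom_dprr _ _ _ _).
by rewrite -!mulmxA -mulmxDr -col_prE cE mulmxA hE f'E.
Qed.

Lemma subquot_mono X M (j : X ~> M) (V : 'M[F]_(mdim M)) :
  ishom j -> row_free j -> (V :=: j)%MS -> subquot 0 V X.
Proof.
move=> hj rj Vj; apply: (@subquot_push _ _ X M j 0 1%:M) => //.
- by apply/eqmxP; rewrite mul0mx !sub0mx.
- by rewrite mul1mx.
rewrite /subquot; split; first by rewrite sub0mx.
exists 1%:M; split; first by move=> a; rewrite !mulmx1 !mul1mx.
  by rewrite mulmx1 row_full_unit unitmx1.
rewrite sub0mx andbT; apply/rV_subP => v; rewrite sub_capmx => /andP[_ /sub_kermxP].
by rewrite mulmx1 => ->; apply: sub0mx.
Qed.

End InjectiveEnvelope.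

Section ProperCostandard.
Variables (F : fieldType) (A : falgType F) (n : nat) (L : 'I_n -> amod A).
Hypothesis labL : simple_labeling L.
Hypothesis covL : forall mu, exists Q, proj_cover Q (L mu).
Implicit Types (M N X Y Z K P E S Q I : amod A) (mu nu : 'I_n).
Local Notation "M ~> N" := 'M[F]_(mdim M, mdim N) : type_scope.

(** Lets a map from P(mu) descend a composition series past every factor other than L(mu). *)
Lemma subquot_hom M (U V : 'M[F]_(mdim M)) Q mu nu (f : Q ~> M) :
  subquot U V (L nu) -> proj_cover Q (L mu) -> mu <> nu -> ishom f ->
  (f <= V)%MS -> (f <= U)%MS.
Proof.
case=> UV [h [hV rV /eqmxP kV]] cQ munu hf fV.
rewrite -kV sub_capmx fV /=; apply/sub_kermxP; apply: NNPP => fh0.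
apply: munu; apply: (cover_hom_simple labL cQ (f := f *m h)) => // a.
have /submxP[d dE] := fV.
by rewrite mulmxA hf dE -!mulmxA; congr (_ *m _); rewrite hV mulmxA.
Qed.

Section Fixed.
Variables (lam : 'I_n) (I : amod A) (j : L lam ~> I).
Hypotheses (iI : injective I) (hj : ishom j) (rj : row_free j).
Hypothesis ess : forall W : 'M[F]_(mdim I), submod W -> \rank W <> 0%N -> \rank (W :&: j)%MS <> 0%N.

Lemma socle_sub (W : 'M_(mdim I)) : submod W -> \rank W <> 0%N -> (j <= W)%MS.
Proof.
move=> sW /(ess sW) r0; have [Q [q [hq rq qW]]] := quoobj sW.
rewrite -qW; apply/sub_kermxP; apply: NNPP => jq0; apply: r0; apply: rank_rV0 => v.
have rjq := simple_mono (simpleL labL lam) (homM hj hq) jq0.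
rewrite sub_capmx -qW => /andP[/sub_kermxP vq /submxP[w wE]].
rewrite wE; suff -> : w = 0 by rewrite mul0mx.
by apply: (row_free_cancel rjq); rewrite mul0mx mulmxA -wE.
Qed.

(* The composition factors of [V / j] are [L mu] with [mu < lam]. *)
Definition below_socle (V : 'M[F]_(mdim I)) :=
  [/\ submod V, (j <= V)%MS & forall mu, ~~ (mu < lam)%N -> forall Q (f : Q ~> I),
    proj_cover Q (L mu) -> ishom f -> (f <= V)%MS -> (f <= j)%MS].

(** Every nonzero submodule of [I] contains the socle L(lam). The chain has no factor L(lam) below
    step [i0], so [s i0] is zero and, comparing ranks, [s i0.+1] is exactly the socle. *)
Lemma pcostd_below_socle V : pcostd_cond L lam V -> below_socle V.
Proof.
case=> sV [l [s [[/eqmxP s0 /eqmxP sl sub] [i0 [i0l sq0 st]]]]].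
have mono k : (i0 + k < l)%N -> (s i0.+1 <= s (i0 + k).+1)%MS.
  elim: k => [|k IH]; first by rewrite addn0.
  rewrite addnS => kl; apply: submx_trans (IH (ltnW kl)) _.
  have [|mu [_ [//]]] := st _ kl; apply/eqP.
  by rewrite -addnS -[X in _ != X]addn0 eqn_add2l.
have desc a b mu Q (f : Q ~> I) : (a <= b)%N -> (b <= l)%N -> ~~ (mu < lam)%N ->
    (forall i, (a <= i)%N -> (i < b)%N -> i <> i0) ->
    proj_cover Q (L mu) -> ishom f -> (f <= s b)%MS -> (f <= s a)%MS.
  move=> + + lm + cQ hf; elim: b => [|b IH].
    by rewrite leqn0 => /eqP->.
  rewrite leq_eqVlt => /orP[/eqP-> //|]; rewrite ltnS => ab bl ne fb.
  apply: IH => //; [exact: ltnW|by move=> i ai ib; apply: ne => //; apply: ltnW|].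
  have [nu [nul sq]] := st _ bl (ne _ ab (leqnn _)).
  by apply: subquot_hom sq cQ _ hf fb => e; move: lm; rewrite e nul.
have i0r : \rank (s i0) = 0%N.
  apply/eqP/negPn/negP => /eqP/(socle_sub (sub _ (ltnW i0l))) ji.
  have [Q cQ] := covL lam; have [pQ [c [hc rc _]]] := cQ.
  have : (c *m j <= s 0%N)%MS.
    apply: (desc 0%N i0 lam) cQ (homM hc hj) _ => //; first exact: ltnW.
    - by rewrite ltnn.
    - by move=> i _ ii0 e; move: ii0; rewrite e ltnn.
    - exact: submx_trans (submxMl _ _) ji.
  rewrite s0 submx0 => /eqP cj0; apply: (hom_nonzero_simple (simpleL labL lam) rc).
  by apply: (row_free_cancel rj); rewrite cj0 mul0mx.
have [X [i [hi ri iX]]] := subobj (sub _ i0l).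
have [K [k [p [S kE]]]] := subquot_ses sq0 hi ri iX.
have K0 : mdim K = 0%N.
  by rewrite -(eqP (row_free_comp (ses_mono S) ri)) kE.
have rk : \rank (s i0.+1) = \rank j.
  by rewrite -iX (eqP ri) (eqP rj) (ses_dim S) K0.
have js : (j <= s i0.+1)%MS.
  apply: socle_sub (sub _ i0l) _; rewrite rk (eqP rj).
  by apply/eqP; rewrite -lt0n; case: (simpleL labL lam).
have sj : (s i0.+1 <= j)%MS.
  by have /leqifP := mxrank_leqif_sup js; case: ifP => // _; rewrite rk ltnn.
split=> //.
  rewrite -sl; apply: submx_trans js _.
  have e : (i0 + (l.-1 - i0))%N = l.-1 by rewrite subnKC // -ltnS (ltn_predK i0l).
  by have := mono (l.-1 - i0)%N; rewrite e (ltn_predK i0l); apply.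
move=> mu lm Q f cQ hf fV; apply: submx_trans sj.
apply: (desc _ l mu) cQ hf _ => //; last by rewrite sl.
by move=> b ib _ e; move: ib; rewrite e ltnn.
Qed.

(** A simple quotient of V/j is split off as the top factor, and induction on the rank ends at the
    socle, which supplies the single factor L(lam). *)
Lemma below_socle_pcostd V : below_socle V -> pcostd_cond L lam V.
Proof.
have [m] := ubnP (\rank V); elim: m V => // m IH V Vm [sV jV fV].
split=> //; case: (boolP (V <= j)%MS) => [Vj|nVj].
  exists 1%N, (fun i => if i is 0%N then 0 else V); split.
    split; [exact/eqmxP|exact/eqmxP|].
    by case=> [|i] _ //; apply: submod0.
  exists 0%N; split=> //; last by case.
  by apply: subquot_mono hj rj _; apply/eqmxP; rewrite Vj jV.
have [X [i [hi ri iX]]] := subobj sV.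
have [|jX hjX jXE] := hom_factor_mono hi ri hj; first by rewrite iX.
have rjX : row_free jX.
  by apply/row_freeP; have /row_freeP[c cE] := rj; exists (i *m c); rewrite mulmxA jXE.
have [Y [c S]] := coker_ses hjX rjX.
have Y0 : (0 < mdim Y)%N.
  rewrite lt0n; apply: contra nVj => /eqP Y0.
  have c0 : c = 0 by apply/matrixP => a b; exfalso; move: (b); rewrite Y0 => -[].
  rewrite -iX -jXE; rewrite -{1}[i]mul1mx.
  by rewrite submxMr //; apply: submx_trans (ses_exact S); apply/sub_kermxP; rewrite c0 mulmx0.
have fY : facs L (fun mu => mu < lam)%N Y.
  move=> mu lm Q f cQ hf.
  have [h [hh <-]] := cQ.1 _ _ c f (ses_homr S) (ses_epi S) hf.
  have : (h *m i <= jX *m i)%MS.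
    by rewrite jXE; apply: (fV mu) cQ (homM hh hi) _ => //; rewrite -iX submxMl.
  case/submxP=> d; rewrite mulmxA => /(row_free_cancel ri) ->.
  by rewrite -mulmxA (ses_comp S) mulmx0.
have [mu [q [hq rq]]] := quo_label labL Y0.
have mul := facs_top labL covL fY hq (hom_nonzero_simple (simpleL labL mu) rq).
have [K [k Sk]] := ker_ses (homM (ses_homr S) hq) (row_full_comp (ses_epi S) rq).
have k1V : (k *m i <= V)%MS by rewrite -iX submxMl.
case: (IH <<k *m i>>%MS).
- rewrite genmxE mxrankMfree // (eqP (ses_mono Sk)) (leq_trans _ (_ : \rank V <= m)%N) //.
  rewrite -iX (eqP ri) (ses_dim Sk) -[X in (X < _)%N]addn0 ltn_add2l.
  by case: (simpleL labL mu).
- split.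
  + exact: hom_im (homM (ses_homl Sk) hi).
  + rewrite genmxE -jXE submxMr //; apply: submx_trans (ses_exact Sk).
    by apply/sub_kermxP; rewrite mulmxA (ses_comp S) mul0mx.
  move=> nu ln Q f cQ hf; rewrite genmxE => fk; apply: fV ln _ _ cQ hf _.
  exact: submx_trans fk k1V.
move=> _ [l [s [[/eqmxP s0 /eqmxP sl sub] [i0 [i0l sq0 st]]]]].
pose s' a := if (a <= l)%N then s a else V.
have s'l a : (a < l)%N -> s' a = s a /\ s' a.+1 = s a.+1.
  by move=> al; rewrite /s' al (ltnW al).
exists l.+1, s'; split.
  split; [by rewrite /s'; apply/eqmxP|by rewrite /s' ltnn; apply/eqmxP|].
  by move=> a _; rewrite /s'; case: ifP => // /sub.
exists i0; split; first exact: ltnW.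
  by have [-> ->] := s'l _ i0l.
move=> a; rewrite ltnS leq_eqVlt => /orP[/eqP->|al] ne; last first.
  by have [-> ->] := s'l _ al; apply: st.
exists mu; split=> //; rewrite /s' leqnn ltnn.
apply: (@subquot_push _ _ X I i <<k>>%MS 1%:M) => //.
- apply: eqmx_trans sl _; apply: eqmx_trans (genmxE _) _; apply: eqmx_sym.
  exact: eqmxMr (genmxE _).
- by rewrite mul1mx; apply: eqmx_sym.
by apply: (subquot_top Sk); [exact: genmxE|rewrite row_full_unit unitmx1].
Qed.

(** By projectivity a map from P(mu) into the sum splits into a part in [V] and a part through [X].
    The condition on [X] is modulo [V], so it also fits a map that extends one already landing in
    [V]. *)
Lemma below_socle_add V X (i : X ~> I) : ishom i -> below_socle V ->
  (forall mu, ~~ (mu < lam)%N -> forall Q (f : Q ~> X), proj_cover Q (L mu) -> ishom f -> (f *m i <= V)%MS) ->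
  below_socle (V + <<i>>)%MS.
Proof.
move=> hi [sV jV fV] fX; split.
- by apply: submod_add sV _; apply: hom_im.
- exact: submx_trans jV (addsmxSl _ _).
move=> mu lm Q f cQ hf fVi; apply: (fV mu lm Q f cQ hf).
have [XV [v [hv rv vV]]] := subobj sV.
have [|f1 [f2 [hf1 hf2 fE]]] := proj_sum_lift cQ.1 hv hi hf.
  apply: submx_trans fVi _; apply: addsmxS; first by rewrite vV.
  by rewrite genmxE.
by rewrite fE addmx_sub //; [rewrite -vV submxMl|apply: (fX mu lm)].
Qed.

Lemma pcostd_max : exists2 V, below_socle V & forall W, below_socle W -> (W <= V)%MS.
Proof.
have [|V gV maxV] := @ex_maxrank _ _ below_socle.
  exists <<j>>%MS; split; [exact: hom_im|by rewrite genmxE|].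
  by move=> mu lm Q f cQ hf; rewrite genmxE.
exists V => // W gW; have [sW jW fW] := gW; have [X [i [hi ri iW]]] := subobj sW.
have gVW : below_socle (V + <<i>>)%MS.
  apply: (below_socle_add hi gV) => mu lm Q f cQ hf.
  apply: submx_trans (_ : (j <= V)%MS); last by case: gV.
  by apply: (fW mu lm) cQ (homM hf hi) _; rewrite -iW submxMl.
have /leqifP := mxrank_leqif_sup (addsmxSl V <<i>>%MS); case: ifP => [|_].
  by move=> /(submx_trans (addsmxSr _ _)); rewrite genmxE iW.
by rewrite ltnNge maxV.
Qed.

End Fixed.

(** [pcostd_ext] reflects the maximality of the submodule of the envelope, [pcostd_mono] the
    essentiality of its socle. *)
Record pcostd_pres lam N Q (j : L lam ~> N) (c : N ~> Q) : Prop := PcostdPres {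
  pcostd_is : is_pcostd L lam N;
  pcostd_ses : ses j c;
  pcostd_facs : facs L (fun mu => mu < lam)%N Q;
  pcostd_ext : forall R, facs L (fun mu => mu < lam)%N R -> ext0 R N;
  pcostd_mono : forall Y (g : N ~> Y), ishom g -> row_free (j *m g) -> row_free g }.

Lemma pcostd_exists lam : exists N Q (j : L lam ~> N) (c : N ~> Q), pcostd_pres j c.
Proof.
have [I eI] := inj_env_exists (L lam); have [iI [j [hj rj ess]]] := eI.
have [V gV maxV] := pcostd_max hj; have [sV jV fV] := gV.
have [N [i [hi ri iV]]] := subobj sV.
have [|jN hjN jNE] := hom_factor_mono hi ri hj; first by rewrite iV.
have rjN : row_free jN.
  by apply/row_freeP; have /row_freeP[c cE] := rj; exists (i *m c); rewrite mulmxA jNE.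
have [Q [c S]] := coker_ses hjN rjN.
exists N, Q, jN, c; split=> //.
- exists I; split=> //; exists V; split.
  + exact: below_socle_pcostd hj rj _ gV.
  + by move=> W /(pcostd_below_socle hj rj ess); apply: maxV.
  + by apply: subquot_mono hi ri _; apply: eqmx_sym.
- move=> mu lm P f cP hf.
  have [h [hh <-]] := cP.1 _ _ c f (ses_homr S) (ses_epi S) hf.
  have : (h *m i <= jN *m i)%MS.
    by rewrite jNE; apply: (fV mu) cP (homM hh hi) _ => //; rewrite -iV submxMl.
  case/submxP=> d; rewrite mulmxA => /(row_free_cancel ri) ->.
  by rewrite -mulmxA (ses_comp S) mulmx0.
- move=> R fR K E k q Sk f hf.
  have [g hg gE] := ext0_inj iI Sk (homM hf hi).
  (* Enlarging [V] by the image of [g] adds only factors of [R], all below [lam]; maximality of [V]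
     therefore forces [g] to land in [N]. *)
  have /maxV gVg : below_socle j (V + <<g>>)%MS.
    apply: below_socle_add hg gV _ => mu lm P u cP hu.
    have [|w hw wE] := ses_factorl Sk hu.
      by apply: (fR mu lm) cP (homM hu (ses_homr Sk)).
    by rewrite -wE -mulmxA gE mulmxA -iV submxMl.
  have [|r hr rE] := hom_factor_mono hi ri hg.
    by rewrite iV -(genmxE g) (submx_trans (addsmxSr _ _) gVg).
  by exists r => //; apply: (row_free_cancel ri); rewrite -mulmxA rE gE.
move=> Y g hg rjg; apply: mono_kerP => v v0.
apply: (row_free_cancel ri); rewrite mul0mx; apply: NNPP => vi0.
have sW := submod_im hi (hom_ker hg).
have /(socle_sub hj ess sW) : \rank <<kermx g *m i>>%MS <> 0%N.
  move=> r0; apply: vi0; apply: rank0_rV r0 _.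
  by rewrite genmxE submxMr //; apply/sub_kermxP.
rewrite genmxE -{1}jNE => /submxP[d]; rewrite mulmxA => /(row_free_cancel ri) jd.
have := hom_nonzero_simplel (simpleL labL lam) rjg; apply.
by rewrite jd -mulmxA mulmx_ker mulmx0.
Qed.

End ProperCostandard.

(** * Universal extensions *)

Section Pushout.
Variables (F : fieldType) (A : falgType F).
Implicit Types (M N X Y Z K P E D : amod A).
Local Notation "M ~> N" := 'M[F]_(mdim M, mdim N) : type_scope.

(** Provides a finite spanning list for Hom(K, X), which is available only as a predicate on
    matrices. *)
Lemma span_exists (V : vectType F) (P : V -> Prop) :
  exists s : seq V, (forall x, x \in s -> P x) /\ forall x, P x -> x \in <<s>>%VS.
Proof.
suff H d : forall s : seq V, (forall x, x \in s -> P x) -> (\dim {:V} - \dim <<s>> <= d)%N ->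
    exists s : seq V, (forall x, x \in s -> P x) /\ forall x, P x -> x \in <<s>>%VS.
  exact: (H _ [::] _ (leqnn _)).
elim: d => [|d IH] s Ps le.
  exists s; split=> // x _; suff -> : <<s>>%VS = fullv by apply: memvf.
  by apply/eqP; rewrite eqEdim subvf -subn_eq0 -leqn0.
case: (classic (exists2 x, P x & x \notin <<s>>%VS)) => [[x Px xs]|nex]; last first.
  by exists s; split=> // x Px; apply/negPn/negP => xs; apply: nex; exists x.
apply: (IH (x :: s)) => [y|]; first by rewrite inE => /orP[/eqP->|/Ps].
rewrite -ltnS; apply: leq_trans le; rewrite ltn_sub2l //.
  rewrite ltnNge; apply: contra xs => le.
  suff -> : <<s>>%VS = fullv by apply: memvf.
  by apply/eqP; rewrite eqEdim subvf.
rewrite ltnNge; apply: contra xs => le.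
suff -> : <<s>>%VS = <<x :: s>>%VS by apply: memv_span; apply: mem_head.
apply/eqP; rewrite eqEdim le andbT; apply: sub_span => y ys.
by rewrite inE ys orbT.
Qed.

(** [Z] is [E] modulo [X1]: the pushout of the extension along the quotient map from [X] to [Y]. *)
Lemma ses_push X1 X Y D E (i1 : X1 ~> X) (p1 : X ~> Y) (i : X ~> E) (p : E ~> D) :
  ses i1 p1 -> ses i p ->
  exists Z (z : E ~> Z) (a : Y ~> Z) (b : Z ~> D), ses (i1 *m i) z /\ ses a b.
Proof.
move=> S1 S; have hi := homM (ses_homl S1) (ses_homl S).
have [Z [z Sz]] := coker_ses hi (row_free_comp (ses_mono S1) (ses_mono S)).
have [|a ha aE] := ses_factorr S1 (homM (ses_homl S) (ses_homr Sz)).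
  by rewrite mulmxA (ses_comp Sz).
have [|b hb bE] := ses_factorr Sz (ses_homr S).
  by rewrite -mulmxA (ses_comp S) mulmx0.
exists Z, z, a, b; split=> //; split=> //.
- apply: mono_kerP => v va.
  have /submxP[w wE] : (v <= p1)%MS by apply: submx_full; apply: ses_epi S1.
  have /sub_kermxP/submx_trans/(_ (ses_exact Sz))/submxP[u uE] : w *m i *m z = 0.
    by rewrite -mulmxA -aE mulmxA -wE.
  have -> : v = u *m i1 *m p1.
    by rewrite wE; congr (_ *m _); apply: (row_free_cancel (ses_mono S)); rewrite -mulmxA.
  by rewrite -mulmxA (ses_comp S1) mulmx0.
- by have /row_fullP[d dE] := ses_epi S; apply/row_fullP; exists (d *m z); rewrite -mulmxA bE.
- by apply: (row_full_cancel (ses_epi S1)); rewrite mulmxA aE -mulmxA bE (ses_comp S) mulmx0.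
apply/rV_subP => v /sub_kermxP vb.
have /submxP[w wE] : (v <= z)%MS by apply: submx_full; apply: ses_epi Sz.
have /sub_kermxP/submx_trans/(_ (ses_exact S))/submxP[u uE] : w *m p = 0.
  by rewrite -bE mulmxA -wE.
by rewrite wE uE -mulmxA -aE mulmxA submxMl.
Qed.

Lemma dsum_id M N : @dprl F A M N *m @dinl F A M N + @dprr F A M N *m @dinr F A M N = 1%:M.
Proof. by rewrite -col_prE; apply: esym; apply: (@scalar_mx_block F (mdim M) (mdim N) 1). Qed.

(** [E] is the cokernel of (f, -k) from [K] to the direct sum of [X] and [P]. *)
Lemma ses_pushout K P D X (k : K ~> P) (q : P ~> D) (f : K ~> X) : ses k q -> ishom f ->
  exists E (u : X ~> E) (d : E ~> D) (g : P ~> E),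
    [/\ ses u d, ishom g & k *m g = f *m u].
Proof.
move=> S hf; pose i : K ~> dsum X P := row_mx f (- k).
have hi : ishom i := hom_row hf (homN (ses_homl S)).
have ir : i *m dprr X P = - k by apply: dprrE.
have ri : row_free i.
  apply: mono_kerP => v v0; apply: (row_free_cancel (ses_mono S)).
  by rewrite mul0mx -[k]opprK -ir mulmxN mulmxA v0 mul0mx oppr0.
have [E [c Sc]] := coker_ses hi ri; have hc := ses_homr Sc.
have [|d hd dE] := ses_factorr Sc (homM (@hom_dprr _ _ X P) (ses_homr S)).
  by rewrite mulmxA ir mulNmx (ses_comp S) oppr0.
have lr : dinl X P *m dprr X P = 0 by apply: dprrE.
have ll : dinl X P *m dprl X P = 1%:M by apply: dprlE.
have rr : dinr X P *m dprr X P = 1%:M by apply: dprrE.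
have kg : k *m (dinr X P *m c) = f *m (dinl X P *m c).
  apply/eqP; rewrite -subr_eq0 -opprB oppr_eq0 -mulNmx !mulmxA -mulmxDl.
  by rewrite -row_inE (ses_comp Sc).
exists E, (dinl X P *m c), d, (dinr X P *m c); split=> //; last exact: homM (@hom_dinr _ _ _ _) hc.
split=> //.
- exact: homM (@hom_dinl _ _ _ _) hc.
- apply: mono_kerP => v; rewrite mulmxA => /sub_kermxP/submx_trans/(_ (ses_exact Sc))/submxP[w wE].
  have w0 : w = 0.
    apply: (row_free_cancel (ses_mono S)).
    by rewrite mul0mx -[k]opprK -ir mulmxN mulmxA -wE -mulmxA lr mulmx0 oppr0.
  by rewrite -[v]mulmx1 -ll mulmxA wE w0 !mul0mx.
- have /row_fullP[e eE] := ses_epi S; apply/row_fullP; exists (e *m (dinr X P *m c)).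
  by rewrite -!mulmxA dE (mulmxA _ _ q) rr mul1mx.
- by rewrite -mulmxA dE mulmxA lr mul0mx.
apply/rV_subP => v /sub_kermxP v0.
have /submxP[w wE] : (v <= c)%MS by apply: submx_full; apply: ses_epi Sc.
have /sub_kermxP/submx_trans/(_ (ses_exact S))/submxP[y yE] : w *m dprr X P *m q = 0.
  by rewrite -mulmxA -dE mulmxA -wE.
rewrite wE -[w]mulmx1 -dsum_id mulmxDr !mulmxA yE mulmxDl.
rewrite addmx_sub //; first by rewrite -mulmxA submxMl.
by rewrite -!mulmxA kg !mulmxA -mulmxA submxMl.
Qed.

Lemma Fil1 (C : amod A -> Prop) X : C X -> Fil C X.
Proof.
move=> CX; have [Z Z0] := @zero_module F A.
apply: (@FilS _ _ C Z X X 0 1%:M) CX; last exact: Fil0.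
split; [exact: hom0|exact: hom1| |by rewrite row_full_unit unitmx1|by rewrite mul0mx|].
  by apply: mono_kerP => v _; apply/matrixP => a b; exfalso; move: (b); rewrite Z0 => -[].
by apply/rV_subP => v /sub_kermxP; rewrite mulmx1 => ->; apply: sub0mx.
Qed.

Lemma ses_id0 X Z : mdim Z = 0%N -> ses (1%:M : X ~> X) (0 : X ~> Z).
Proof.
move=> Z0; split; [exact: hom1|exact: hom0|by rewrite row_free_unit unitmx1| |by rewrite mulmx0|exact: submx1].
by rewrite /row_full mxrank0 Z0.
Qed.

(** Ext^1(D, X) is Hom(K, X) modulo restrictions from [P] when [P] is projective. Pushing out along
    a spanning list, one map at a time, adds one copy of [D] per map until every class dies in [E].
    That Ext^1(D, E) itself vanishes needs more, namely that maps from [K] to [E] land in [X]. *)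
Lemma universal_extension K P D X (k : K ~> P) (q : P ~> D) : ses k q ->
  exists E Z (u : X ~> E) (z : E ~> Z), [/\ ses u z, Fil (eq D) Z &
    forall f : K ~> X, ishom f -> exists2 g : P ~> E, ishom g & k *m g = f *m u].
Proof.
move=> S; have [s [hs ss]] := span_exists (fun f : K ~> X => ishom f).
suff [E [Z [u [z [Su FZ H]]]]] : exists E Z (u : X ~> E) (z : E ~> Z), [/\ ses u z, Fil (eq D) Z &
    forall f : K ~> X, f \in s -> exists2 g : P ~> E, ishom g & k *m g = f *m u].
  exists E, Z, u, z; split=> // f /ss fs.
  have /fin_all_exists2[g hg gE] (a : 'I_(size s)) : exists2 g : P ~> E, ishom g & k *m g = s`_a *m u.
    by apply: H; apply: mem_nth.
  exists (\sum_a (coord (in_tuple s) a f *: g a)).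
    by apply: hom_sum => a; apply: homZ.
  rewrite [in RHS](coord_span (X := in_tuple s) fs) mulmx_suml mulmx_sumr.
  by apply: eq_bigr => a _; rewrite -scalemxAr gE scalemxAl.
elim: s hs {ss} => [|f s IH] hs.
  have [Z Z0] := @zero_module F A.
  by exists X, Z, 1%:M, 0; split; [exact: ses_id0|exact: Fil0|].
have [|E [Z [u [z [Su FZ H]]]]] := IH; first by move=> g gs; apply: hs; rewrite inE gs orbT.
have [|E2 [u2 [d [g [S2 hg gE]]]]] := ses_pushout S (homM (hs f _) (ses_homl Su)).
  exact: mem_head.
have [Z2 [z2 [a [b [Sz Sab]]]]] := ses_push Su S2.
exists E2, Z2, (u *m u2), z2; split=> //; first by apply: FilS Sab FZ _.
move=> f'; rewrite inE => /orP[/eqP->|/H[h hh hE]]; first by exists g; rewrite ?mulmxA.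
exists (h *m u2); first exact: homM hh (ses_homl S2).
by rewrite mulmxA hE mulmxA.
Qed.

Lemma pd_le_Fil (C : amod A -> Prop) t X : (forall Y, C Y -> pd_le t Y) -> Fil C X -> pd_le t X.
Proof.
move=> H; elim=> [Z Z0|X' E Y i p S _ pX /H pY]; last exact: pd_le_ext S pX pY.
by move=> N _; apply: ext0_zerol.
Qed.

Lemma ord_min n (P : 'I_n -> Prop) : (exists i, P i) ->
  exists2 i, P i & forall j : 'I_n, (j < i)%N -> ~ P j.
Proof.
case=> i; have [m] := ubnP i; elim: m i => // m IH i im Pi.
case: (classic (exists2 j : 'I_n, (j < i)%N & P j)) => [[j ji Pj]|nex].
  by apply: (IH j) Pj; apply: leq_trans ji im.
by exists i => // j ji Pj; apply: nex; exists j.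
Qed.

End Pushout.

(** * Strongly standardly stratified algebras *)

Section Stratified.
Variables (F : fieldType) (A : falgType F) (n : nat) (L : 'I_n -> amod A).
Hypotheses (labL : simple_labeling L) (sss : SSS L).
Implicit Types (M N X Y Z K P E D S Q I : amod A) (mu nu lam : 'I_n).
Local Notation "M ~> N" := 'M[F]_(mdim M, mdim N) : type_scope.

Definition std X := exists lam, is_std L lam X.
(** The presentation is part of the notion, so its properties are at hand without comparing models
    of the same module. *)
Definition pcostd X := exists lam Q (j : L lam ~> X) (c : X ~> Q), pcostd_pres j c.
Local Notation facs_le lam := (facs L (fun mu => mu <= lam)%N).

(** A nonzero map from [A] to L(mu) descends the Delta-filtration to a nonzero map on some layer
    Delta(lam), and then lam = mu. Thus the filtration of [A] itself yields all standard modules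
    and, with them, all projective covers. *)
Lemma std_exists mu : exists D, is_std L mu D.
Proof.
have [L0 _] := simpleL labL mu.
pose x : 'rV[F]_(mdim (L mu)) := delta_mx 0 (Ordinal L0).
have x0 : freehom x <> 0.
  move=> e; have := freehom1 x; rewrite e mulmx0 => /matrixP/(_ 0 (Ordinal L0))/eqP.
  by rewrite !mxE !eqxx eq_sym oner_eq0.
have := inF_Fil sss; have := hom_free x; move: x0; move: (freehom x).
move: (regmod A) => X f f0 hf FX; elim: FX f f0 hf => [Z Z0|X' E Y i p S _ IH [lam sY]] f f0 hf.
  by have [] := hom_nonzero_dim f0; rewrite Z0.
case: (classic (i *m f = 0)) => [if0|if0]; last exact: IH if0 (homM (ses_homl S) hf).
have [g hg gE] := ses_factorr S hf if0.
have [P [K [k [q [t st]]]]] := std_presP labL sY.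
have Sq := std_ses st.
suff <- : lam = mu by exists Y.
apply: (cover_hom_simple labL (std_cover st) (homM (ses_homr Sq) hg)) => qg0.
by apply: f0; rewrite -gE (row_full_cancel (ses_epi Sq) (_ : q *m g = q *m 0)) ?mulmx0.
Qed.

Lemma covers mu : exists Q, proj_cover Q (L mu).
Proof.
have [D /(std_presP labL)[P [K [k [q [t st]]]]]] := std_exists mu.
by exists P; apply: std_cover st.
Qed.

Lemma ext0_std_facs lam D N : is_std L lam D -> facs_le lam N -> ext0 D N.
Proof.
case/(std_presP labL)=> P [K [k [q [t st]]]] fN.
apply: (ext0_pres (std_ses st) (std_cover st).1) => f hf.
by exists 0; [exact: hom0|rewrite mulmx0 (std_tors st fN hf)].
Qed.

Lemma pcostd_facs_le lam N Q (j : L lam ~> N) (c : N ~> Q) : pcostd_pres j c -> facs_le lam N.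
Proof.
move=> pN; apply: facs_ext (pcostd_ses pN) _ _; first exact: facs_simple.
by apply: facsW (pcostd_facs pN) => mu /ltnW.
Qed.

(** The larger label decides: for nu <= lam the syzygy of [D] has no map to [N], and for lam < nu
    all factors of [D] lie below the socle label of [N]. *)
Lemma ext0_std_pcostd D N : std D -> pcostd N -> ext0 D N.
Proof.
case=> lam sD [nu [Q [j [c pN]]]]; case: (leqP nu lam) => [nl|ln].
  by apply: (ext0_std_facs sD); apply: facsW (pcostd_facs_le pN) => mu /leq_trans; apply.
have [P [K [k [q [t st]]]]] := std_presP labL sD.
by apply: (pcostd_ext pN); apply: facsW (std_facs st) => mu /leq_ltn_trans; apply.
Qed.

Definition torsion mu X := forall N, facs_le mu N -> forall f : X ~> N, ishom f -> f = 0.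

(* The torsion submodule is the trace of the P(nu), nu > mu; Ext^1(Delta(nu), -) = 0 on the
   torsion-free quotient lets a top factor Delta(nu), nu > mu, be absorbed into it. *)
Lemma torsion_ses mu X : Fil std X -> exists X1 X2 (i : X1 ~> X) (p : X ~> X2),
  [/\ ses i p, torsion mu X1, facs_le mu X2 & forall N, pcostd N -> ext0 X1 N].
Proof.
elim=> {X} [Z Z0|X1 X D i p S _ [X1' [X1'' [i1 [p1 [S1 t1 f1 e1]]]]] [nu sD]].
  exists Z, Z, 1%:M, 0; split; first exact: ses_id0.
  - by move=> N _ f _; apply/matrixP => a b; exfalso; move: (a); rewrite Z0 => -[].
  - by move=> nu _ Q f _ _; apply/matrixP => a b; exfalso; move: (b); rewrite Z0 => -[].
  - by move=> N _; apply: ext0_zerol.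
have [P [K [k [q [t st]]]]] := std_presP labL sD.
case: (leqP nu mu) => [numu|munu].
  have [Z [z [a [b [Sz Sab]]]]] := ses_push S1 S.
  exists X1', Z, (i1 *m i), z; split=> //; apply: (facs_ext Sab f1).
  by apply: facsW (std_facs st) => kap /leq_trans; apply.
(* Here nu > mu: the projection [p1] extends over the whole module, so the torsion-free quotient is
   unchanged and the new torsion part ker r is an extension of Delta(nu) by the old one. *)
have [|r hr rE] := @ext0_std_facs nu D X1'' sD _ _ _ _ _ S _ (ses_homr S1).
  by apply: facsW f1 => kap /leq_trans; apply; apply: ltnW.
have rr : row_full r.
  by have /row_fullP[d dE] := ses_epi S1; apply/row_fullP; exists (d *m i); rewrite -mulmxA rE.
have [X' [i' S']] := ker_ses hr rr.
have [|a ha aE] := ses_factorl S' (homM (ses_homl S1) (ses_homl S)).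
  by rewrite -mulmxA rE (ses_comp S1).
have Sa : ses a (i' *m p).
  split=> //.
  - exact: homM (ses_homl S') (ses_homr S).
  - have /row_freeP[c cE] := row_free_comp (ses_mono S1) (ses_mono S).
    by apply/row_freeP; exists (i' *m c); rewrite mulmxA aE.
  - have /row_fullP[d dE] := ses_epi S.
    have /submxP[u uE] : (d *m r <= p1)%MS by apply: submx_full; apply: ses_epi S1.
    have /sub_kermxP/submx_trans/(_ (ses_exact S'))/submxP[w wE] : (d - u *m i) *m r = 0.
      by rewrite mulmxBl -mulmxA rE uE subrr.
    apply/row_fullP; exists w; rewrite mulmxA -wE mulmxBl -mulmxA (ses_comp S) mulmx0 subr0.
    exact: dE.
  - by rewrite mulmxA aE -mulmxA (ses_comp S) mulmx0.
  apply/rV_subP => v /sub_kermxP; rewrite mulmxA => /sub_kermxP/submx_trans/(_ (ses_exact S))/submxP[w wE].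
  have /sub_kermxP/submx_trans/(_ (ses_exact S1))/submxP[u uE] : w *m p1 = 0.
    by rewrite -rE mulmxA -wE -mulmxA (ses_comp S') mulmx0.
  suff -> : v = u *m a by apply: submxMl.
  by apply: (row_free_cancel (ses_mono S')); rewrite wE uE -!mulmxA aE.
exists X', X1'', i', r; split=> //.
- move=> N fN f hf; have [|g hg <-] := ses_factorr Sa hf.
    by apply: (t1 N fN); apply: homM.
  suff -> : g = 0 by rewrite mulmx0.
  apply: (row_full_cancel (ses_epi (std_ses st))); rewrite mulmx0.
  apply: (fN nu _ P) (std_cover st) (homM (ses_homr (std_ses st)) hg).
  by rewrite -ltnNge.
by move=> N pN; apply: ext0_extl Sa (e1 N pN) (ext0_std_pcostd _ pN); exists nu.
Qed.

(** Any vector outside the kernel of the cover generates [P], so [P] is a quotient of [A] and splits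
    off. *)
Lemma cover_retract P lam : proj_cover P (L lam) ->
  exists (s : P ~> regmod A) (w : regmod A ~> P), [/\ ishom s, ishom w & s *m w = 1%:M].
Proof.
case=> pP [c [hc rc sup]].
have [x x0] : exists x : 'rV_(mdim P), x *m c <> 0.
  apply: NNPP => nex; apply: (hom_nonzero_simple (simpleL labL lam) rc).
  apply/row_matrixP => i; rewrite row0 rowE; apply: NNPP => xc.
  by apply: nex; exists (delta_mx 0 i).
have rw : row_full (freehom x).
  apply: proj_cover_superfluous sup (hom_free x) _.
  apply: simple_epi (simpleL labL lam) (homM (hom_free x) hc) _ => e.
  by apply: x0; rewrite -[x]freehom1 -mulmxA e mulmx0.
have [s [hs sE]] := pP _ _ (freehom x) 1%:M (hom_free x) rw (@hom1 _ _ P).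
by exists s, (freehom x); split=> //; apply: hom_free.
Qed.

(* Ext^2(D, N) = 0 for [D] standard and [N] proper costandard. *)
Lemma ext0_syzygy lam D P K (k : K ~> P) (q : P ~> D) (t : D ~> L lam) N :
  std_pres k q t -> pcostd N -> ext0 K N.
Proof.
move=> st pN; have Sk := std_ses st.
have [X1 [X2 [i [p [S t1 f2 e1]]]]] := torsion_ses lam (inF_Fil sss).
have [s [w [hs hw sw]]] := cover_retract (std_cover st).
(* [K] is torsion, so [s] carries it into the torsion part [X1] of [A]; [X1] is torsion, so its
   image under [w] vanishes in [D] and lies in [K]. As [s *m w] is the identity, [K] is a retract of
   [X1]. *)
have [|u hu uE] := ses_factorl S (homM (ses_homl Sk) hs).
  by apply: (std_tors st f2); apply: homM (homM (ses_homl Sk) hs) (ses_homr S).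
have [|v hv vE] := ses_factorl Sk (homM (ses_homl S) hw).
  by apply: (t1 _ (std_facs st)); apply: homM (homM (ses_homl S) hw) (ses_homr Sk).
apply: ext0_retract hu hv _ (e1 N pN).
apply: (row_free_cancel (ses_mono Sk)).
by rewrite -mulmxA vE mulmxA uE -mulmxA sw mulmx1 mul1mx.
Qed.

(** Let lam be the least label in the top of [X]. For mu <= lam there is no nonzero map from [X] to
    nabla-bar(mu)/L(mu), whose factors are below lam, so Ext^1(X, L(mu)) = 0. Hence Ext^1(X, rad
    Delta(lam)) = 0, and a map onto L(lam) lifts to a surjection onto Delta(lam). The kernel is
    smaller and still orthogonal. *)
Lemma Fil_std_of_ext X : (forall N, pcostd N -> ext0 X N) -> Fil std X.
Proof.
have [m] := ubnP (mdim X); elim: m X => // m IH X Xm eX.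
case: (posnP (mdim X)) => [X0|X0]; first exact: Fil0.
have [lam [f [hf f0]] minl] : exists2 lam, exists f : X ~> L lam, ishom f /\ f <> 0 &
    forall mu, (mu < lam)%N -> ~ exists f : X ~> L mu, ishom f /\ f <> 0.
  apply: ord_min; have [mu [q [hq rq]]] := quo_label labL X0.
  by exists mu, q; split=> //; apply: hom_nonzero_simple (simpleL labL mu) rq.
have eL mu : (mu <= lam)%N -> ext0 X (L mu).
  move=> ml; have [N [Q [j [c pN]]]] := pcostd_exists labL covers mu.
  apply: ext0_sub (pcostd_ses pN) (eX N _) _; first by exists mu, Q, j, c.
  move=> g hg; apply: NNPP => g0.
  have [I [a [i [nu [b [ha hi ra ri [hb rb]]]]]]] := hom_to_simple labL hg g0.
  have nm : (nu < mu)%N.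
    apply: (facs_top labL covers (facs_sub hi ri (pcostd_facs pN)) hb).
    exact: hom_nonzero_simple (simpleL labL nu) rb.
  apply: (minl nu (leq_trans nm ml)); exists (a *m b); split; first exact: homM.
  by apply: hom_nonzero_simple (simpleL labL nu) _; apply: row_full_comp.
have [D sD] := std_exists lam; have [P [K [k [q [t st]]]]] := std_presP labL sD.
have [R [r Sr]] := ker_ses (std_homt st) (std_fullt st).
have eR : ext0 X R.
  apply: (facs_ext0r labL covers eL).
  exact: facs_sub (ses_homl Sr) (ses_mono Sr) (std_facs st).
have [h hh hE] := ext0_lift eR Sr hf.
have rh : row_full h.
  by apply: (std_top st hh); rewrite hE; apply: simple_epi (simpleL labL lam) hf f0.
have [X' [i S]] := ker_ses hh rh.
apply: (FilS S); last by exists lam.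
apply: IH.
  move: Xm; rewrite (ses_dim S) ltnS => /(leq_trans _); apply.
  rewrite -[X in (X < _)%N]addn0 ltn_add2l lt0n; apply/negP => /eqP D0.
  have := hom_nonzero_simple (simpleL labL lam) (std_fullt st); apply.
  by apply/matrixP => a b; exfalso; move: (a); rewrite D0 => -[].
move=> N pN; have [I [a [iI ha ra]]] := enough_inj N.
have [N' [b Sa]] := coker_ses ha ra.
apply: (ext0_ker S Sa iI (eX N pN)).
(* Ext^2(D, N) = 0, expressed as Ext^1 from [D] to the cosyzygy [N']. *)
apply: (ext0_quo (std_ses st) (std_cover st).1 (ext0_syzygy st pN) Sa).
exact: ext0_inj.
Qed.

(** Dually, let lam be the least label in the socle of [Y]. For mu < lam there is no nonzero map
    from rad Delta(mu) to [Y], so Ext^1(L(mu), Y) = 0 and an embedding of L(lam) extends to one of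
    nabla-bar(lam). Asking for one standard module per label avoids uniqueness up to isomorphism. *)
Lemma Fil_pcostd_of_ext Y : (forall mu, exists2 D, is_std L mu D & ext0 D Y) ->
  Fil (fun N => exists lam, is_pcostd L lam N) Y.
Proof.
have [m] := ubnP (mdim Y); elim: m Y => // m IH Y Ym eY.
case: (posnP (mdim Y)) => [Y0|Y0]; first exact: Fil0.
have [lam [f [hf f0]] minl] : exists2 lam, exists f : L lam ~> Y, ishom f /\ f <> 0 &
    forall mu, (mu < lam)%N -> ~ exists f : L mu ~> Y, ishom f /\ f <> 0.
  apply: ord_min; have [mu [j [hj rj]]] := sub_label labL Y0.
  by exists mu, j; split=> //; apply: hom_nonzero_simplel (simpleL labL mu) rj.
have eL mu : (mu < lam)%N -> ext0 (L mu) Y.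
  move=> ml; have [D sD eD] := eY mu; have [P [K [k [q [t st]]]]] := std_presP labL sD.
  have [R [r Sr]] := ker_ses (std_homt st) (std_fullt st).
  apply: (ext0_topquo Sr eD) => g hg; apply: NNPP => g0.
  have fR := facs_sub (ses_homl Sr) (ses_mono Sr) (std_facs st).
  have [I [a [i [ha hi ra ri gE]]]] := im_factor hg.
  have a0 : a <> 0 by move=> a0; apply: g0; rewrite gE a0 mul0mx.
  have [_ /(sub_label labL)[nu [j [hj rj]]]] := hom_nonzero_dim a0.
  have nm : (nu <= mu)%N.
    apply: (facs_socle labL covers (facs_quo ha ra fR) hj).
    exact: hom_nonzero_simplel (simpleL labL nu) rj.
  apply: (minl nu (leq_ltn_trans nm ml)); exists (j *m i); split; first exact: homM.
  by apply: hom_nonzero_simplel (simpleL labL nu) _; apply: row_free_comp.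
have [N [Q [j [c pN]]]] := pcostd_exists labL covers lam.
have [g hg gE] := facs_ext0l labL covers eL (pcostd_facs pN) (pcostd_ses pN) hf.
have rg : row_free g.
  by apply: (pcostd_mono pN hg); rewrite gE; apply: simple_mono (simpleL labL lam) hf f0.
have [Y' [p S]] := coker_ses hg rg.
apply: (Fil_ext S); first by apply: Fil1; exists lam; apply: pcostd_is pN.
apply: IH.
  move: Ym; rewrite (ses_dim S) ltnS => /(leq_trans _); apply.
  rewrite -[X in (X < _)%N]add0n ltn_add2r (ses_dim (pcostd_ses pN)) addn_gt0.
  by case: (simpleL labL lam) => ->.
move=> mu; have [D sD eD] := eY mu; exists D => //.
have [P [K [k [q [t st]]]]] := std_presP labL sD.
apply: (ext0_quo (std_ses st) (std_cover st).1 _ S eD).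
by apply: (ext0_syzygy st); exists lam, Q, j, c.
Qed.

Lemma facs_of_Fil p (C : amod A -> Prop) X : (forall Y, C Y -> facs L p Y) -> Fil C X -> facs L p X.
Proof.
move=> H; elim=> [Z Z0|X' E Y i q S _ fX /H fY]; last exact: facs_ext S fX fY.
by move=> mu _ Q f _ _; apply/matrixP => a b; exfalso; move: (b); rewrite Z0 => -[].
Qed.

(** Labels are treated downwards from lam - 1, step [d] killing Ext^1 from Delta(lam - d). The order
    matters: the copies of Delta(nu) added at a step have factors at most nu, so the vanishing
    already achieved for mu > nu survives. For mu >= lam it holds at the start. *)
Lemma std_coresolution lam D : is_std L lam D ->
  exists T Z (u : D ~> T) (z : T ~> Z), [/\ ses u z,
    Fil (fun X => exists2 mu : 'I_n, (mu < lam)%N & is_std L mu X) Z &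
    forall mu, exists2 D', is_std L mu D' & ext0 D' T].
Proof.
move=> sD.
suff H d : (d <= lam)%N -> exists T Z (u : D ~> T) (z : T ~> Z), [/\ ses u z,
    Fil (fun X => exists2 mu : 'I_n, (mu < lam)%N & is_std L mu X) Z &
    forall mu, (lam - d <= mu)%N -> exists2 D', is_std L mu D' & ext0 D' T].
  have [T [Z [u [z [S FZ eT]]]]] := H _ (leqnn _).
  by exists T, Z, u, z; split=> // mu; apply: eT; rewrite subnn.
elim: d => [_|d IH dl].
  have [Z Z0] := @zero_module F A; exists D, Z, 1%:M, 0.
  split; [exact: ses_id0|exact: Fil0|move=> mu; rewrite subn0 => lm].
  have [D' sD'] := std_exists mu; exists D' => //; apply: (ext0_std_facs sD').
  have [P [K [k [q [t st]]]]] := std_presP labL sD.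
  by apply: facsW (std_facs st) => nu /leq_trans; apply.
have [T [Z [u [z [S FZ eT]]]]] := IH (ltnW dl).
have nul : (lam - d.+1 < lam)%N by rewrite ltn_subrL (leq_trans _ dl).
pose nu := Ordinal (ltn_trans nul (ltn_ord lam)).
have [D1 sD1] := std_exists nu; have [P [K [k [q [t st]]]]] := std_presP labL sD1.
have [T' [Z' [u' [z' [S' FZ' ext]]]]] := universal_extension T (std_ses st).
have fZ' : facs_le nu Z' by apply: facs_of_Fil FZ' => _ <-; apply: std_facs st.
have [Z2 [z2 [a [b [S2 Sab]]]]] := ses_push S S'.
exists T', Z2, (u *m u'), z2; split=> //.
  by apply: Fil_ext Sab FZ _; apply: Fil_mono FZ' => _ <-; exists nu.
move=> mu; rewrite leq_eqVlt => /orP[/eqP nm|nm].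
  have <- : nu = mu by apply: val_inj.
  exists D1 => //; apply: (ext0_pres (std_ses st) (std_cover st).1) => f hf.
  (* [K] has no nonzero map to [Z'], so [f] lands in [T], where the universal extension makes it
     extend to [P]. *)
  have [|f1 hf1 <-] := ses_factorl S' hf; first exact: (std_tors st fZ' (homM hf (ses_homr S'))).
  exact: ext.
have [|D' sD' eD'] := eT mu; first by rewrite -(subnSK dl).
exists D' => //; apply: ext0_extr S' eD' (ext0_std_facs sD' _).
by apply: facsW fZ' => kap /leq_trans; apply; apply: ltnW.
Qed.

Lemma pd_le_std t : (forall M, inFDelta L M -> inFpnabla L M -> pd_le t M) ->
  forall D, std D -> pd_le t D.
Proof.
move=> tilt D [lam]; have [m] := ubnP lam; elim: m lam D => // m IH lam D lm sD.
have [T [Z [u [z [S FZ eT]]]]] := std_coresolution sD.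
apply: (pd_le_ker S).
  apply: tilt; apply: Fil_inF; last exact: Fil_pcostd_of_ext.
  apply: (Fil_ext S); first by apply: Fil1; exists lam.
  by apply: Fil_mono FZ => X [mu _ sX]; exists mu.
(* A kernel requires only pd Z <= t + 1; the induction gives [t]. *)
apply: (@pd_leW _ _ t) => //; apply: pd_le_Fil FZ => X [mu ml sX].
by apply: IH sX; apply: leq_trans ml lm.
Qed.

End Stratified.

Theorem theorem3 (F : closedFieldType) (A : falgType F) (n : nat)
  (L : 'I_n -> amod A) (T : amod A) (k t : nat) :
  simple_labeling L ->
  SSS L ->
  char_tilting L T ->
  fdimDelta_le L k ->
  pdim_le T t ->
  fdim_le A (k + t).
Proof.
move=> labL sss [_ tilt] fdD [s [[rT _] st]] N p [rN minN].
have pT : pd_le t T.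
  apply: (pd_leW st); rewrite -[s]addn0; apply: pd_le_res rT => P.
  exact: pd_le_proj.
have pD X : inFDelta L X -> pd_le t X.
  move/inF_Fil; apply: pd_le_Fil; apply: pd_le_std => // M DM nM.
  have [m [i [q [hi hq iq]]]] : in_add T M by apply/tilt.
  by move=> Y cY; apply: ext0_sum_retract hi hq iq (pT Y cY).
have rD : exists l, has_res (inFDelta L) N l.
  (* A projective resolution is already a Delta-resolution, since projectives have vanishing Ext^1
     into every proper costandard module. *)
  exists p; have [X [f [f0 [CX hf rf e r]]]] := rN.
  exists X, f, f0; split=> // i il; apply/Fil_inF/Fil_std_of_ext => // Y _.
  exact: ext0_proj (CX i il).
have [l [rl minl]] : exists l, has_res (inFDelta L) N l /\
    forall l', has_res (inFDelta L) N l' -> (l <= l')%N.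
  (* [fdimDelta_le] bounds minimal lengths only, so a shortest Delta-resolution has to be
     selected. *)
  case: rD => l; have [m] := ubnP l; elim: m l => // m IH l lm rl.
  case: (classic (exists2 l', (l' < l)%N & has_res (inFDelta L) N l')) => [[l' ll rl']|nex].
    by apply: (IH l') rl'; apply: leq_trans ll lm.
  exists l; split=> // l' rl'; rewrite leqNgt; apply/negP => ll.
  by apply: nex; exists l'.
have lk : (l <= k)%N by apply: (fdD N l).
apply: (@leq_trans (l + t)); last by rewrite leq_add2r.
by apply/minN/has_res_proj; apply: pd_le_res rl.
Qed.
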